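(* Let $\mathbf{k}=(k_1,k_2,\dots)\in\mathbb{Z}_{\geq0}^{\infty}$ be an infinite sequence of non-negative integers, let $N>1$ and $n\geq0$. The centraliser $\overline{H}^N_{\mathbf{k},n}(q)$ coincides with the algebra $H_{\mathbf{k},n}(q)$ (that is, the surjection $H_{\mathbf{k},n}(q)\to\overline{H}^N_{\mathbf{k},n}(q)$ is an isomorphism) if and only if $n\leq N$.
   Context: $q\in\mathbb{C}^{\times}$ with $q^2$ not a non-trivial root of unity ($q^2=1$ allowed). $H_m(q)$ is the $\mathbb{C}$-algebra generated by $\sigma_1,\dots,\sigma_{m-1}$ with relations $\sigma_i^2=(q-q^{-1})\sigma_i+1$, $\sigma_i\sigma_{i+1}\sigma_i=\sigma_{i+1}\sigma_i\sigma_{i+1}$, $\sigma_i\sigma_j=\sigma_j\sigma_i$ if $|i-j|>1$, with $H_0(q)=H_1(q)=\mathbb{C}$; $\sigma_w$ ($w$ in the symmetric group $\mathfrak{S}_m$) is its standard basis, obtained from reduced expressions, and $\ell$ is the length function on $\mathfrak{S}_m$. $P_m=\bigl(\sum_{w\in\mathfrak{S}_m}q^{\ell(w)}\sigma_w\bigr)/\bigl(\sum_{w\in\mathfrak{S}_m}q^{2\ell(w)}\bigr)$ is the $q$-symmetriser (with $P_0=1$) and $P_{\mathbf{k},n}:=P_{k_1}\otimes\dots\otimes P_{k_n}\in H_{k_1}(q)\otimes\dots\otimes H_{k_n}(q)\subset H_{k_1+\dots+k_n}(q)$ (parabolic subalgebra). The fused Hecke algebra $H_{\mathbf{k},n}(q)$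 is identified with $P_{\mathbf{k},n}H_{k_1+\dots+k_n}(q)P_{\mathbf{k},n}$ (unit $P_{\mathbf{k},n}$; in the paper it is defined by diagrams, ''fused braids'', and shown isomorphic to this algebra); $H_{\mathbf{k},0}(q)=\mathbb{C}$. $U_q(gl_N)$ is the standard deformation of $U(gl_N)$ ($U_1(gl_N)=U(gl_N)$), $L^N_{(1)}$ its $N$-dimensional vector representation, $L^N_{(k)}$ its irreducible representation with highest weight $(k)$ (deformed $k$-th symmetric power; $L^N_{(0)}$ is the trivial representation, and for $n=0$ the tensor product below is the trivial representation). $H_m(q)$ acts on $(L^N_{(1)})^{\otimes m}$, commuting with $U_q(gl_N)$, by letting $\sigma_i$ act as $\check R$ on factors $i,i+1$, where in a suitable basis $e_1,\dots,e_N$: $\check R(e_i\otimes e_j)=q\,e_i\otimes e_j$ if $i=j$, $e_j\otimes e_i+(q-q^{-1})e_i\otimes e_j$ if $i<j$, $e_j\otimes e_i$ if $i>j$. The image of $P_{\mathbf{k},n}$ on $(L^N_{(1)})^{\otimes k_1+\dots+k_n}$ is $L^N_{(k_1)}\otimes\dots\otimes L^N_{(k_n)}$, so $H_{\mathbf{k},n}(q)$ acts on $L^N_{(k_1)}\otimes\dots\otimes L^N_{(k_n)}$ by restriction; $\overline{H}^N_{\mathbf{k},n}(q)$ is the image of $H_{\mathbf{k},n}(q)$ in $\mathrm{End}(L^N_{(k_1)}\otimes\dots\otimes L^N_{(k_n)})$, which is the centraliser of the action of $U_q(gl_N)$.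
   Formalization: The ''only if'' direction is proved only when k_1,...,k_n are all positive; with zero entries it can fail (k=(0,0,...), N=2, n=3: both algebras are C although n>N). The ''if'' direction is proved for all sequences of non-negative integers. *)

(* Defs.v *)
From HB Require Import structures.
From mathcomp Require Import all_boot all_order all_fingroup all_algebra.
From mathcomp Require Import generic_quotient.
From mathcomp Require Import boolp classical_sets functions reals.
From mathcomp Require Import complex.
From mathcomp Require Import ring zify.

Set Implicit Arguments.
Unset Strict Implicit.
Unset Printing Implicit Defensive.

Import GRing.Theory.

Local Open Scope ring_scope.
Local Open Scope quotient_scope.

Section AdjacentTranspositions.
Variable m : nat.
Implicit Types (i : 'I_m.-1) (w : 'S_m) (s : seq 'I_m.-1).

Fact ltn_pos_lo i : (i < m)%N.
Proof. exact: leq_trans (ltn_ord i) (leq_pred m). Qed.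

Fact ltn_pos_hi i : (i.+1 < m)%N.
Proof. by rewrite -ltn_predRL. Qed.

Definition pos_lo i : 'I_m := Ordinal (ltn_pos_lo i).
Definition pos_hi i : 'I_m := Ordinal (ltn_pos_hi i).

Definition adj_tperm i : 'S_m := tperm (pos_lo i) (pos_hi i).

(* MathComp multiplies permutations from left to right.  With the other
   convention a word would give the inverse permutation, which has the same
   length, so [qsymmetriser] below is the same element. *)
Definition word_perm s : 'S_m := (\prod_(i <- s) adj_tperm i)%g.

Lemma word_perm_cat s1 s2 :
  word_perm (s1 ++ s2) = (word_perm s1 * word_perm s2)%g.
Proof. by rewrite /word_perm big_cat. Qed.

Lemma tperm_word d (x y : 'I_m) :
  (x + d.+1 = y)%N -> exists s, word_perm s = tperm x y.
Proof.
elim: d y => [|d IHd] y Exy.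
  have lt_x : (x < m.-1)%N by have := ltn_ord y; rewrite -Exy addn1 ltn_predRL.
  exists [:: Ordinal lt_x]; rewrite /word_perm big_seq1 /adj_tperm.
  by congr tperm; apply: val_inj => //=; rewrite -Exy addn1.
have lt_xd : (x + d.+1 < m.-1)%N.
  by have := ltn_ord y; rewrite -Exy addnS ltn_predRL.
pose i : 'I_m.-1 := Ordinal lt_xd.
have [s Es] := IHd (pos_lo i) (erefl _).
exists ([:: i] ++ s ++ [:: i]).
have -> : y = pos_hi i by apply: val_inj; rewrite /= -Exy addnS.
have nlo : pos_lo i != x by rewrite -val_eqE /= addnS -addSn neq_ltn leq_addr orbT.
have nhi : pos_hi i != x by rewrite -val_eqE /= -addSn neq_ltn leq_addr orbT.
rewrite !word_perm_cat Es /word_perm !big_seq1 -[X in (X * _)%g]tpermV -/(adj_tperm i).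
by rewrite -conjgE tpermJ /adj_tperm tpermL tpermD.
Qed.

Lemma word_permP w : exists s, word_perm s = w.
Proof.
have [ts -> _] := prod_tpermP w.
elim: ts => [|[x y] ts [s Es]]; first by exists [::]; rewrite /word_perm !big_nil.
rewrite big_cons -Es /=.
suff [s' <-] : exists s', word_perm s' = tperm x y.
  by exists (s' ++ s); rewrite word_perm_cat.
have [lt_xy|lt_yx|/val_inj ->] := ltngtP x y.
- by apply: (@tperm_word (y - x.+1)); rewrite addnS -addSn subnKC.
- rewrite tpermC.
  by apply: (@tperm_word (x - y.+1)); rewrite addnS -addSn subnKC.
- by exists [::]; rewrite tperm1 /word_perm big_nil.
Qed.

Fact perm_length_subproof w :
  exists l, [exists s : l.-tuple 'I_m.-1, word_perm s == w].
Proof.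
have [s <-] := word_permP w.
by exists (size s); apply/existsP; exists (in_tuple s).
Qed.

Definition perm_length w : nat := ex_minn (perm_length_subproof w).

Fact reduced_word_subproof w :
  exists s : (perm_length w).-tuple 'I_m.-1, word_perm s == w.
Proof. by rewrite /perm_length; case: ex_minnP => l /existsP. Qed.

Definition reduced_word w : seq 'I_m.-1 := xchoose (reduced_word_subproof w).

Lemma reduced_wordP w : word_perm (reduced_word w) = w.
Proof. exact/eqP/(xchooseP (reduced_word_subproof w)). Qed.

Lemma size_reduced_word w : size (reduced_word w) = perm_length w.
Proof. exact: size_tuple. Qed.

Lemma perm_length_min w s : word_perm s = w -> (perm_length w <= size s)%N.
Proof.
rewrite /perm_length; case: ex_minnP => l _ min_l Es; apply: min_l.
by apply/existsP; exists (in_tuple s); apply/eqP.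
Qed.

End AdjacentTranspositions.

Inductive hterm (K : Type) (m : nat) : Type :=
| HGen of 'I_m.-1
| HScal of K
| HAdd of hterm K m & hterm K m
| HMul of hterm K m & hterm K m.

Arguments HGen {K m}.
Arguments HScal {K m}.

HB.instance Definition _ K m := gen_eqMixin (hterm K m).
HB.instance Definition _ K m := gen_choiceMixin (hterm K m).

(* The least congruence making terms an associative unital K-algebra in which
   the Hecke relations hold. *)
Inductive hcong (K : fieldType) (q : K) (m : nat) :
  hterm K m -> hterm K m -> Prop :=
| HCrefl t : hcong q t t
| HCsym t u : hcong q t u -> hcong q u t
| HCtrans t u v : hcong q t u -> hcong q u v -> hcong q t v
| HCadd t t' u u' :
    hcong q t t' -> hcong q u u' -> hcong q (HAdd t u) (HAdd t' u')
| HCmul t t' u u' :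
    hcong q t t' -> hcong q u u' -> hcong q (HMul t u) (HMul t' u')
| HCaddA t u v : hcong q (HAdd t (HAdd u v)) (HAdd (HAdd t u) v)
| HCaddC t u : hcong q (HAdd t u) (HAdd u t)
| HCadd0 t : hcong q (HAdd (HScal 0) t) t
| HCaddN t : hcong q (HAdd (HMul (HScal (-1)) t) t) (HScal 0)
| HCmulA t u v : hcong q (HMul t (HMul u v)) (HMul (HMul t u) v)
| HCmul1l t : hcong q (HMul (HScal 1) t) t
| HCmul1r t : hcong q (HMul t (HScal 1)) t
| HCmulDl t u v : hcong q (HMul (HAdd t u) v) (HAdd (HMul t v) (HMul u v))
| HCmulDr t u v : hcong q (HMul t (HAdd u v)) (HAdd (HMul t u) (HMul t v))
| HCscalD a b : hcong q (HScal (a + b)) (HAdd (HScal a) (HScal b))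
| HCscalM a b : hcong q (HScal (a * b)) (HMul (HScal a) (HScal b))
| HCscalC a t : hcong q (HMul (HScal a) t) (HMul t (HScal a))
| HCquad i :
    hcong q (HMul (HGen i) (HGen i))
            (HAdd (HMul (HScal (q - q^-1)) (HGen i)) (HScal 1))
| HCbraid (i j : 'I_m.-1) : j = i.+1 :> nat ->
    hcong q (HMul (HMul (HGen i) (HGen j)) (HGen i))
            (HMul (HMul (HGen j) (HGen i)) (HGen j))
| HCcomm (i j : 'I_m.-1) : (i.+1 < j)%N ->
    hcong q (HMul (HGen i) (HGen j)) (HMul (HGen j) (HGen i)).

Section HeckeDef.
Variables (K : fieldType) (q : K) (m : nat).

Definition hequiv (t u : hterm K m) : bool := `[< hcong q t u >].

Fact hequiv_refl : reflexive hequiv.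
Proof. by move=> t; apply/asboolP/HCrefl. Qed.

Fact hequiv_sym : symmetric hequiv.
Proof. by move=> t u; apply/asboolP/asboolP => /HCsym. Qed.

Fact hequiv_trans : transitive hequiv.
Proof.
by move=> u t v /asboolP Htu /asboolP Huv; apply/asboolP/(HCtrans Htu Huv).
Qed.

Canonical hequiv_rel := EquivRel hequiv hequiv_refl hequiv_sym hequiv_trans.

Definition hecke := {eq_quot hequiv_rel}.

HB.instance Definition _ := Choice.on hecke.
HB.instance Definition _ := Quotient.on hecke.
HB.instance Definition _ := EqQuotient.on hecke.

Lemma hecke_eqP t u : hcong q t u <-> \pi_hecke t = \pi_hecke u.
Proof.
split=> [Htu|/eqmodP/asboolP//].
by apply/eqmodP/asboolP.
Qed.

Lemma hecke_repr t : hcong q (repr (\pi_hecke t)) t.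
Proof. by apply/hecke_eqP; rewrite reprK. Qed.

Definition hecke_scalar (a : K) : hecke := \pi_hecke (HScal a).
Definition hecke_add (x y : hecke) : hecke := \pi_hecke (HAdd (repr x) (repr y)).
Definition hecke_mul (x y : hecke) : hecke := \pi_hecke (HMul (repr x) (repr y)).
Definition hecke_scale (a : K) (x : hecke) : hecke :=
  hecke_mul (hecke_scalar a) x.
Definition hecke_opp (x : hecke) : hecke := hecke_scale (-1) x.

Lemma hecke_addE t u :
  hecke_add (\pi_hecke t) (\pi_hecke u) = \pi_hecke (HAdd t u).
Proof. by apply/hecke_eqP/HCadd; apply: hecke_repr. Qed.

Lemma hecke_mulE t u :
  hecke_mul (\pi_hecke t) (\pi_hecke u) = \pi_hecke (HMul t u).
Proof. by apply/hecke_eqP/HCmul; apply: hecke_repr. Qed.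

Fact hecke_addA : associative hecke_add.
Proof.
elim/quotW=> t; elim/quotW=> u; elim/quotW=> v.
rewrite (hecke_addE u) (hecke_addE t u) (hecke_addE t) hecke_addE.
by apply/hecke_eqP/HCaddA.
Qed.

Fact hecke_addC : commutative hecke_add.
Proof.
elim/quotW=> t; elim/quotW=> u; rewrite (hecke_addE t) (hecke_addE u).
by apply/hecke_eqP/HCaddC.
Qed.

Fact hecke_add0 : left_id (hecke_scalar 0) hecke_add.
Proof. by elim/quotW=> t; rewrite hecke_addE; apply/hecke_eqP/HCadd0. Qed.

Fact hecke_addN : left_inverse (hecke_scalar 0) hecke_opp hecke_add.
Proof.
elim/quotW=> t; rewrite /hecke_opp /hecke_scale (hecke_mulE _ t) hecke_addE.
by apply/hecke_eqP/HCaddN.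
Qed.

Fact hecke_mulA : associative hecke_mul.
Proof.
elim/quotW=> t; elim/quotW=> u; elim/quotW=> v.
rewrite (hecke_mulE u) (hecke_mulE t u) (hecke_mulE t) hecke_mulE.
by apply/hecke_eqP/HCmulA.
Qed.

Fact hecke_mul1l : left_id (hecke_scalar 1) hecke_mul.
Proof. by elim/quotW=> t; rewrite hecke_mulE; apply/hecke_eqP/HCmul1l. Qed.

Fact hecke_mul1r : right_id (hecke_scalar 1) hecke_mul.
Proof. by elim/quotW=> t; rewrite hecke_mulE; apply/hecke_eqP/HCmul1r. Qed.

Fact hecke_mulDl : left_distributive hecke_mul hecke_add.
Proof.
elim/quotW=> t; elim/quotW=> u; elim/quotW=> v.
rewrite (hecke_addE t u) (hecke_mulE t v) (hecke_mulE u v) hecke_mulE hecke_addE.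
by apply/hecke_eqP/HCmulDl.
Qed.

Fact hecke_mulDr : right_distributive hecke_mul hecke_add.
Proof.
elim/quotW=> t; elim/quotW=> u; elim/quotW=> v.
rewrite (hecke_addE u v) (hecke_mulE t u) (hecke_mulE t v) hecke_mulE hecke_addE.
by apply/hecke_eqP/HCmulDr.
Qed.

Fact hecke_scalarD a b :
  hecke_scalar (a + b) = hecke_add (hecke_scalar a) (hecke_scalar b).
Proof. by rewrite hecke_addE; apply/hecke_eqP/HCscalD. Qed.

Fact hecke_scalarM a b :
  hecke_scalar (a * b) = hecke_mul (hecke_scalar a) (hecke_scalar b).
Proof. by rewrite hecke_mulE; apply/hecke_eqP/HCscalM. Qed.

Fact hecke_scalarC a x : hecke_mul (hecke_scalar a) x = hecke_mul x (hecke_scalar a).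
Proof.
elim/quotW: x => t; rewrite (hecke_mulE _ t) (hecke_mulE t).
by apply/hecke_eqP/HCscalC.
Qed.

End HeckeDef.

(* Hecke terms are evaluated in a vector space with an explicit algebra law:
   the product of MathComp's algebra structures on 'End(V) is the opposite of
   composition, and those structures only exist for V <> 0. *)

Record alg_law (K : fieldType) (A : lmodType K) (one : A) (mul : A -> A -> A) :
    Prop := AlgLaw {
  alg_mulA : associative mul;
  alg_mul1l : left_id one mul;
  alg_mul1r : right_id one mul;
  alg_mulDl : left_distributive mul +%R;
  alg_mulDr : right_distributive mul +%R;
  alg_scaleAl : forall a x y, mul (a *: x) y = a *: mul x y;
  alg_scaleAr : forall a x y, mul x (a *: y) = a *: mul x y
}.

Record hecke_relations (K : fieldType) (q : K) (m : nat) (A : lmodType K)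
    (one : A) (mul : A -> A -> A) (f : 'I_m.-1 -> A) : Prop := HeckeRelations {
  hecke_rel_quad i : mul (f i) (f i) = (q - q^-1) *: f i + one;
  hecke_rel_braid (i j : 'I_m.-1) : j = i.+1 :> nat ->
    mul (mul (f i) (f j)) (f i) = mul (mul (f j) (f i)) (f j);
  hecke_rel_comm (i j : 'I_m.-1) : (i.+1 < j)%N -> mul (f i) (f j) = mul (f j) (f i)
}.

Section HeckeEval.
Variables (K : fieldType) (q : K) (m : nat) (A : lmodType K).
Variables (one : A) (mul : A -> A -> A) (f : 'I_m.-1 -> A).

Fixpoint heval (t : hterm K m) : A :=
  match t with
  | HGen i => f i
  | HScal a => a *: one
  | HAdd t u => heval t + heval u
  | HMul t u => mul (heval t) (heval u)
  end.

Hypotheses (lawA : alg_law one mul) (relf : hecke_relations q one mul f).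

Lemma heval_hcong t u : hcong q t u -> heval t = heval u.
Proof.
elim=> {t u} //=.
- by move=> t u v _ -> _ ->.
- by move=> t t' u u' _ -> _ ->.
- by move=> t t' u u' _ -> _ ->.
- by move=> t u v; rewrite addrA.
- by move=> t u; rewrite addrC.
- by move=> t; rewrite scale0r add0r.
- move=> t; rewrite (alg_scaleAl lawA) (alg_mul1l lawA).
  by rewrite scaleN1r addNr scale0r.
- by move=> t u v; rewrite (alg_mulA lawA).
- by move=> t; rewrite scale1r (alg_mul1l lawA).
- by move=> t; rewrite scale1r (alg_mul1r lawA).
- by move=> t u v; rewrite (alg_mulDl lawA).
- by move=> t u v; rewrite (alg_mulDr lawA).
- by move=> a b; rewrite scalerDl.
- by move=> a b; rewrite (alg_scaleAl lawA) (alg_mul1l lawA) scalerA.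
- move=> a t; rewrite (alg_scaleAl lawA) (alg_mul1l lawA).
  by rewrite (alg_scaleAr lawA) (alg_mul1r lawA).
- move=> i; rewrite (hecke_rel_quad relf) (alg_scaleAl lawA) (alg_mul1l lawA).
  by rewrite scale1r.
- exact: (hecke_rel_braid relf).
- exact: (hecke_rel_comm relf).
Qed.

End HeckeEval.

Section HeckeAlgebra.
Variables (K : fieldType) (q : K) (m : nat).

HB.instance Definition _ := GRing.isZmodule.Build (hecke q m)
  (@hecke_addA K q m) (@hecke_addC K q m) (@hecke_add0 K q m)
  (@hecke_addN K q m).

Fact regular_alg_law : @alg_law K K^o 1 *%R.
Proof.
split; [exact: mulrA | exact: mul1r | exact: mulr1 | exact: mulrDl
       | exact: mulrDr | by move=> a x y; rewrite -scalerAl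
       | by move=> a x y; rewrite -scalerAr].
Qed.

(* The character sigma_i |-> q (sigma_i |-> 1 in the degenerate case q = 0). *)
Fact hecke_one_neq0 : @hecke_scalar K q m 1 != 0.
Proof.
apply/eqP => /hecke_eqP Heq.
have relq : hecke_relations q 1 *%R
    (fun _ : 'I_m.-1 => (if q == 0 then 1 else q) : K^o).
  split=> // i; rewrite /GRing.scale /=; case: (eqVneq q 0) => [->|q0].
    by rewrite invr0; ring.
  by rewrite mulrBl mulVf // subrK.
move: (heval_hcong regular_alg_law relq Heq) => /=.
by rewrite scale1r scale0r => /eqP; rewrite oner_eq0.
Qed.

HB.instance Definition _ := GRing.Zmodule_isNzRing.Build (hecke q m)
  (@hecke_mulA K q m) (@hecke_mul1l K q m) (@hecke_mul1r K q m)
  (@hecke_mulDl K q m) (@hecke_mulDr K q m) hecke_one_neq0.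

Fact hecke_scaleA a b (x : hecke q m) :
  hecke_scale a (hecke_scale b x) = hecke_scale (a * b) x.
Proof. by rewrite /hecke_scale hecke_mulA hecke_scalarM. Qed.

Fact hecke_scale1 : left_id 1 (@hecke_scale K q m).
Proof. exact: hecke_mul1l. Qed.

Fact hecke_scaleDr : right_distributive (@hecke_scale K q m) +%R.
Proof. by move=> a x y; exact: hecke_mulDr. Qed.

Fact hecke_scaleDl (x : hecke q m) : {morph (@hecke_scale K q m)^~ x : a b / a + b}.
Proof. by move=> a b; rewrite /hecke_scale hecke_scalarD hecke_mulDl. Qed.

HB.instance Definition _ := GRing.Zmodule_isLmodule.Build K (hecke q m)
  hecke_scaleA hecke_scale1 hecke_scaleDr hecke_scaleDl.

Fact hecke_scaleAl a (x y : hecke q m) : a *: (x * y) = (a *: x) * y.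
Proof. exact: hecke_mulA. Qed.

HB.instance Definition _ := GRing.Lmodule_isLalgebra.Build K (hecke q m)
  hecke_scaleAl.

Fact hecke_scaleAr a (x y : hecke q m) : a *: (x * y) = x * (a *: y).
Proof.
rewrite -[LHS]/(hecke_mul (hecke_scalar q m a) (hecke_mul x y)).
rewrite -[RHS]/(hecke_mul x (hecke_mul (hecke_scalar q m a) y)).
by rewrite !hecke_mulA hecke_scalarC.
Qed.

HB.instance Definition _ := GRing.Lalgebra_isAlgebra.Build K (hecke q m)
  hecke_scaleAr.

Definition hecke_gen (i : 'I_m.-1) : hecke q m := \pi_(hecke q m) (HGen i).

Definition hecke_word (s : seq 'I_m.-1) : hecke q m := \prod_(i <- s) hecke_gen i.

(* By Matsumoto's theorem this does not depend on the reduced word. *)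
Definition hecke_std (w : 'S_m) : hecke q m := hecke_word (reduced_word w).

Definition qsymmetriser : hecke q m :=
  (\sum_(w : 'S_m) q ^+ (2 * perm_length w))^-1 *:
  \sum_(w : 'S_m) q ^+ perm_length w *: hecke_std w.

Lemma hecke_gen_relations : hecke_relations q 1 *%R hecke_gen.
Proof.
have mulE t u : \pi_(hecke q m) t * \pi_(hecke q m) u = \pi_(hecke q m) (HMul t u).
  exact: hecke_mulE.
have addE t u : \pi_(hecke q m) t + \pi_(hecke q m) u = \pi_(hecke q m) (HAdd t u).
  exact: hecke_addE.
have scaleE a t : a *: \pi_(hecke q m) t = \pi_(hecke q m) (HMul (HScal a) t).
  exact: hecke_mulE.
have oneE : 1 = \pi_(hecke q m) (HScal 1) by [].
split=> [i|i j ij|i j ij]; rewrite /hecke_gen.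
- by rewrite mulE scaleE oneE addE; apply/hecke_eqP/HCquad.
- by rewrite (mulE (HGen i)) (mulE (HGen j) (HGen i)) !mulE; apply/hecke_eqP/HCbraid.
- by rewrite !mulE; apply/hecke_eqP/HCcomm.
Qed.

End HeckeAlgebra.

Section HeckeLift.
Variables (K : fieldType) (q : K) (m : nat) (A : lmodType K).
Variables (one : A) (mul : A -> A -> A) (f : 'I_m.-1 -> A).

Definition hecke_lift (x : hecke q m) : A := heval one mul f (repr x).

Hypotheses (lawA : alg_law one mul) (relf : hecke_relations q one mul f).

Lemma hecke_lift_pi t : hecke_lift (\pi_(hecke q m) t) = heval one mul f t.
Proof. exact: (heval_hcong lawA relf (hecke_repr q t)). Qed.

Lemma hecke_lift_gen i : hecke_lift (hecke_gen q i) = f i.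
Proof. exact: hecke_lift_pi. Qed.

Lemma hecke_lift1 : hecke_lift 1 = one.
Proof. by rewrite [LHS]hecke_lift_pi /= scale1r. Qed.

Lemma hecke_liftD x y : hecke_lift (x + y) = hecke_lift x + hecke_lift y.
Proof. by rewrite [LHS]hecke_lift_pi. Qed.

Lemma hecke_liftM x y : hecke_lift (x * y) = mul (hecke_lift x) (hecke_lift y).
Proof. by rewrite [LHS]hecke_lift_pi. Qed.

Lemma hecke_liftZ a x : hecke_lift (a *: x) = a *: hecke_lift x.
Proof.
rewrite [LHS]hecke_liftM [hecke_lift (hecke_scalar _ _ _)]hecke_lift_pi /=.
by rewrite (alg_scaleAl lawA) (alg_mul1l lawA).
Qed.

End HeckeLift.

Section TensorRep.
Variables (K : fieldType) (q : K) (N m : nat).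

(* [v] stands for the sum of the [v t *: e_(t 0) (x) ... (x) e_(t (m - 1))]. *)
Definition tensor_space := {ffun {ffun 'I_m -> 'I_N} -> K^o}.

HB.instance Definition _ := Vector.on tensor_space.

Implicit Types (t : {ffun 'I_m -> 'I_N}) (i : 'I_m.-1) (v : tensor_space).

Definition tensor_basis t : tensor_space := [ffun s => (s == t)%:R].

Definition tensor_swap i t : {ffun 'I_m -> 'I_N} := [ffun a => t (adj_tperm i a)].

Definition Rcheck_basis i t : tensor_space :=
  if t (pos_lo i) == t (pos_hi i) then q *: tensor_basis t
  else if (t (pos_lo i) < t (pos_hi i))%N then
    tensor_basis (tensor_swap i t) + (q - q^-1) *: tensor_basis t
  else tensor_basis (tensor_swap i t).

Definition Rcheck_fun i v : tensor_space := \sum_t v t *: Rcheck_basis i t.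

Fact Rcheck_fun_is_linear i : linear (Rcheck_fun i).
Proof.
move=> a u v; rewrite /Rcheck_fun scaler_sumr -big_split /=.
by apply: eq_bigr => t _; rewrite !ffunE scalerDl scalerA.
Qed.

HB.instance Definition _ i :=
  GRing.isLinear.Build K tensor_space tensor_space *:%R (Rcheck_fun i)
    (Rcheck_fun_is_linear i).

Definition Rcheck i : 'End(tensor_space) := linfun (Rcheck_fun i).

Lemma tensor_basisE v : v = \sum_t v t *: tensor_basis t.
Proof.
apply/ffunP=> s; rewrite sum_ffunE (bigD1 s) //= big1 => [|t nts].
  by rewrite !ffunE eqxx addr0 /GRing.scale /= mulr1.
by rewrite !ffunE eq_sym (negPf nts) scaler0.
Qed.

Lemma Rcheck_tensor_basis i t : Rcheck i (tensor_basis t) = Rcheck_basis i t.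
Proof.
rewrite lfunE /= /Rcheck_fun (bigD1 t) //= big1 => [|s nst].
  by rewrite ffunE eqxx addr0 scale1r.
by rewrite ffunE (negPf nst) scale0r.
Qed.

Lemma tensor_lfunP (f g : 'End(tensor_space)) :
  (forall t, f (tensor_basis t) = g (tensor_basis t)) -> f = g.
Proof.
move=> fg; apply/lfunP=> v; rewrite [v]tensor_basisE !linear_sum.
by apply: eq_bigr => t _; rewrite !linearZ /= fg.
Qed.

Lemma tensor_swapK i : involutive (tensor_swap i).
Proof. by move=> t; apply/ffunP=> a; rewrite !ffunE tpermK. Qed.

Lemma tensor_swap_id i t : t (pos_lo i) = t (pos_hi i) -> tensor_swap i t = t.
Proof.
by move=> Et; apply/ffunP=> a; rewrite ffunE /adj_tperm; case: tpermP => // ->.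
Qed.

Lemma tensor_swap_lo i t : tensor_swap i t (pos_lo i) = t (pos_hi i).
Proof. by rewrite ffunE tpermL. Qed.

Lemma tensor_swap_hi i t : tensor_swap i t (pos_hi i) = t (pos_lo i).
Proof. by rewrite ffunE tpermR. Qed.

Let al (a b : 'I_N) : K := if a == b then q else 1.
Let be (a b : 'I_N) : K := if (a < b)%N then q - q^-1 else 0.

Let RcheckE i t : Rcheck i (tensor_basis t) =
  al (t (pos_lo i)) (t (pos_hi i)) *: tensor_basis (tensor_swap i t) +
  be (t (pos_lo i)) (t (pos_hi i)) *: tensor_basis t.
Proof.
rewrite Rcheck_tensor_basis /Rcheck_basis /al /be.
case: eqP => [Et|_]; first by rewrite Et ltnn scale0r addr0 tensor_swap_id.
by case: ifP => _; rewrite scale1r ?scale0r ?addr0.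
Qed.

Lemma comp_lfun_alg_law : alg_law \1%VF (@comp_lfun K tensor_space _ tensor_space).
Proof.
split.
- by move=> f g h; rewrite comp_lfunA.
- exact: comp_lfun1l.
- exact: comp_lfun1r.
- by move=> f g h; rewrite comp_lfunDl.
- by move=> f g h; rewrite comp_lfunDr.
- by move=> a f g; rewrite comp_lfunZl.
- by move=> a f g; rewrite comp_lfunZr.
Qed.

Hypothesis q_neq0 : q != 0.

Lemma Rcheck_quad i :
  (Rcheck i \o Rcheck i)%VF = (q - q^-1) *: Rcheck i + \1%VF.
Proof.
apply: tensor_lfunP => t.
rewrite comp_lfunE add_lfunE scale_lfunE id_lfunE.
rewrite !RcheckE linearD !linearZ /= !RcheckE.
rewrite tensor_swap_lo tensor_swap_hi tensor_swapK /al /be.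
case: (ltngtP (t (pos_lo i)) (t (pos_hi i))) => [lt|gt|/val_inj Et].
- have nE : (t (pos_lo i) == t (pos_hi i)) = false by rewrite -val_eqE ltn_eqF.
  rewrite nE eq_sym nE.
  by apply/ffunP=> s; rewrite !ffunE /GRing.scale /=; ring.
- have nE : (t (pos_lo i) == t (pos_hi i)) = false by rewrite -val_eqE gtn_eqF.
  rewrite nE eq_sym nE.
  by apply/ffunP=> s; rewrite !ffunE /GRing.scale /=; ring.
- rewrite Et eqxx tensor_swap_id //.
  by apply/ffunP=> s; rewrite !ffunE /GRing.scale /=; field.
Qed.

Lemma Rcheck_comm (i j : 'I_m.-1) : (i.+1 < j)%N ->
  (Rcheck i \o Rcheck j)%VF = (Rcheck j \o Rcheck i)%VF.
Proof.
move=> ij; apply: tensor_lfunP => t.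
have nlj a b : (a == pos_lo i) || (a == pos_hi i) ->
    (b == pos_lo j) || (b == pos_hi j) -> a != b.
  by case/orP=> /eqP-> /orP[]/eqP->; rewrite -val_eqE /=; lia.
have njl a b : (a == pos_lo i) || (a == pos_hi i) ->
    (b == pos_lo j) || (b == pos_hi j) -> b != a.
  by move=> ai bj; rewrite eq_sym nlj.
have swij a : (a == pos_lo i) || (a == pos_hi i) -> tensor_swap j t a = t a.
  move=> ai; rewrite ffunE /adj_tperm tpermD // eq_sym nlj ?eqxx ?orbT //.
have swji a : (a == pos_lo j) || (a == pos_hi j) -> tensor_swap i t a = t a.
  move=> ai; rewrite ffunE /adj_tperm tpermD // nlj ?eqxx ?orbT //.
have swC : tensor_swap i (tensor_swap j t) = tensor_swap j (tensor_swap i t).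
  apply/ffunP=> a; rewrite !ffunE /adj_tperm; congr (t _).
  have [->|->|/eqP a1 /eqP a2] := tpermP (pos_lo i) (pos_hi i) a.
  - by rewrite !(@tpermD _ (pos_lo j)) ?tpermL // njl ?eqxx ?orbT.
  - by rewrite !(@tpermD _ (pos_lo j)) ?tpermR // njl ?eqxx ?orbT.
  case: (tpermP (pos_lo j) (pos_hi j) a) => [_|_|_ _].
  - by rewrite tpermD // nlj ?eqxx ?orbT.
  - by rewrite tpermD // nlj ?eqxx ?orbT.
  - by rewrite !tpermD // eq_sym.
rewrite !comp_lfunE !RcheckE !linearD !linearZ /= !RcheckE.
rewrite !swij ?swji ?eqxx ?orbT // swC.
by apply/ffunP=> s; rewrite !ffunE /GRing.scale /=; ring.
Qed.

Lemma braid_core (V : lmodType K) (S T : Type) (ev : S -> V -> K)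
    (e : T -> V) (si sj : T -> T) (t0 : T) (x y z : 'I_N) :
  (forall s a (u v : V), ev s (a *: u + v) = a * ev s u + ev s v) ->
  (forall (u v : V), (forall s, ev s u = ev s v) -> u = v) ->
  (x = y -> si t0 = t0) -> (y = z -> sj t0 = t0) ->
  (x = z -> si (sj t0) = sj t0 /\ sj (si t0) = si t0) ->
  si (sj (si t0)) = sj (si (sj t0)) ->
  al x y *: (al x z *: (al y z *: e (si (sj (si t0))) + be y z *: e (sj (si t0)))
           + be x z *: (al y x *: e t0 + be y x *: e (si t0))) +
  be x y *: (al y z *: (al x z *: e (si (sj t0)) + be x z *: e (sj t0))
           + be y z *: (al x y *: e (si t0) + be x y *: e t0)) =
  al y z *: (al x z *: (al x y *: e (sj (si (sj t0))) + be x y *: e (si (sj t0)))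
           + be x z *: (al z y *: e t0 + be z y *: e (sj t0))) +
  be y z *: (al x y *: (al x z *: e (sj (si t0)) + be x z *: e (si t0))
           + be x y *: (al y z *: e (sj t0) + be y z *: e t0)).
Proof.
move=> evP evI Exy Eyz Exz swB; apply: evI => s.
have evD (u v : V) : ev s (u + v) = ev s u + ev s v.
  by rewrite -[u in LHS]scale1r evP mul1r.
have evZ a (u : V) : ev s (a *: u) = a * ev s u.
  have ev0 : ev s 0 = 0 by apply: (addrI (ev s 0)); rewrite -evD !addr0.
  by rewrite -[a *: u]addr0 evP ev0 addr0.
rewrite !(evD, evZ).
move: Exy Eyz Exz swB; rewrite /al /be -!val_eqE /=.
case: (ltngtP x y) => [xy|yx|/val_inj xy];
case: (ltngtP y z) => [yz|zy|/val_inj yz];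
case: (ltngtP x z) => [xz|zx|/val_inj xz];
move=> Exy Eyz Exz swB;
  try (by exfalso; lia); try (by exfalso; have /= := congr1 val xz; lia);
  try (by exfalso; have /= := congr1 val yz; lia);
  try (by exfalso; have /= := congr1 val xy; lia).
all: rewrite -?swB.
all: try rewrite (Exy xy).
all: try (rewrite swB (Eyz yz)).
all: try (rewrite swB; have [-> ->] := Exz xz).
all: by [ring | field].
Qed.

Lemma Rcheck_braid (i j : 'I_m.-1) : j = i.+1 :> nat ->
  (Rcheck i \o Rcheck j \o Rcheck i)%VF = (Rcheck j \o Rcheck i \o Rcheck j)%VF.
Proof.
move=> ij; apply: tensor_lfunP => t.
have loj : pos_lo j = pos_hi i by apply: val_inj.
have n01 : pos_lo i != pos_hi i by rewrite -val_eqE /=; lia.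
have n02 : pos_lo i != pos_hi j by rewrite -val_eqE /=; lia.
have n12 : pos_hi i != pos_hi j by rewrite -val_eqE /=; lia.
have swi_hj u : tensor_swap i u (pos_hi j) = u (pos_hi j).
  by rewrite ffunE /adj_tperm tpermD.
have swj_li u : tensor_swap j u (pos_lo i) = u (pos_lo i).
  by rewrite ffunE /adj_tperm tpermD // ?loj eq_sym.
have swj_hi u : tensor_swap j u (pos_hi i) = u (pos_hi j).
  by rewrite -loj tensor_swap_lo.
have swj_hj u : tensor_swap j u (pos_hi j) = u (pos_hi i).
  by rewrite tensor_swap_hi loj.
have swB : tensor_swap i (tensor_swap j (tensor_swap i t)) =
           tensor_swap j (tensor_swap i (tensor_swap j t)).
  apply/ffunP=> a; rewrite !ffunE /adj_tperm loj; congr (t _).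
  set si := tperm (pos_lo i) _; set sj := tperm (pos_hi i) _.
  suff /permP/(_ a) : (si * sj * si = sj * si * sj)%g by rewrite !permM.
  rewrite -{1}[si]tpermV -{2}[sj]tpermV -/si -/sj -2!mulgA -!conjgE !tpermJ.
  by rewrite tpermL tpermR !tpermD // eq_sym.
rewrite !comp_lfunE.
have RDZ l a b u v :
    Rcheck l (a *: u + b *: v) = a *: Rcheck l u + b *: Rcheck l v.
  by rewrite linearD !linearZ.
rewrite !RcheckE !RDZ !RcheckE !RDZ !RcheckE loj.
rewrite ?(tensor_swap_lo, tensor_swap_hi, swi_hj, swj_li, swj_hi, swj_hj).
rewrite ?loj !tensor_swapK.
pose ev s (u : tensor_space) : K := u s.
have evP s a (u v : tensor_space) : ev s (a *: u + v) = a * ev s u + ev s v.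
  by rewrite /ev !ffunE.
have evI u v : (forall s, ev s u = ev s v) -> u = v by move=> /ffunP.
apply: (@braid_core tensor_space _ _ ev tensor_basis (tensor_swap i)
  (tensor_swap j) t _ _ _ evP evI _ _ _ swB).
- exact: tensor_swap_id.
- by move=> E; rewrite tensor_swap_id // loj.
- move=> E; split; apply: tensor_swap_id; first by rewrite swj_li swj_hi.
  by rewrite loj tensor_swap_hi swi_hj.
Qed.

Lemma Rcheck_relations :
  hecke_relations q \1%VF (@comp_lfun K tensor_space _ tensor_space) Rcheck.
Proof.
split; [exact: Rcheck_quad | exact: Rcheck_braid | exact: Rcheck_comm].
Qed.

End TensorRep.

Section HeckeRep.
Variables (K : fieldType) (q : K) (N m : nat).

Definition hecke_rep : hecke q m -> 'End(tensor_space K N m) :=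
  hecke_lift \1%VF (@comp_lfun K _ _ _) (@Rcheck K q N m).

Lemma hecke_repM (q_neq0 : q != 0) x y :
  hecke_rep (x * y) = (hecke_rep x \o hecke_rep y)%VF.
Proof.
exact: (hecke_liftM (@comp_lfun_alg_law K N m) (Rcheck_relations N m q_neq0)).
Qed.

Lemma hecke_rep1 (q_neq0 : q != 0) : hecke_rep 1 = \1%VF.
Proof.
exact: (hecke_lift1 (@comp_lfun_alg_law K N m) (Rcheck_relations N m q_neq0)).
Qed.

Lemma hecke_rep_gen (q_neq0 : q != 0) i : hecke_rep (hecke_gen q i) = Rcheck q N i.
Proof.
exact: (hecke_lift_gen (@comp_lfun_alg_law K N m) (Rcheck_relations N m q_neq0)).
Qed.

Lemma hecke_rep_linear (q_neq0 : q != 0) : linear hecke_rep.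
Proof.
move=> a x y.
have law := @comp_lfun_alg_law K N m; have rel := Rcheck_relations N m q_neq0.
by rewrite /hecke_rep (hecke_liftD law rel) (hecke_liftZ law rel).
Qed.

End HeckeRep.

Section Fused.
Variables (K : fieldType) (q : K) (k : nat -> nat) (n : nat).

(* The sequence k is indexed from 0. *)
Definition ksum (j : nat) : nat := \sum_(l < j) k l.

Fact block_gen_subproof (j : 'I_n) (i : 'I_(k j).-1) :
  (ksum j + i < (ksum n).-1)%N.
Proof.
have lt_i : (i.+1 < k j)%N by rewrite -ltn_predRL.
have le_j : (ksum j + k j <= ksum n)%N.
  rewrite /ksum -(big_ord_recr j (fun l => k l)) /=.
  by rewrite -!(big_mkord xpredT) (@big_cat_nat _ _ _ j.+1 0 n) //= leq_addr.
by rewrite ltn_predRL -addnS; apply: leq_trans le_j; rewrite ltn_add2l.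
Qed.

Definition block_gen (j : 'I_n) (i : 'I_(k j).-1) : 'I_(ksum n).-1 :=
  Ordinal (block_gen_subproof i).

(* The inclusion of the j-th tensor factor of the parabolic subalgebra
   H_(k_1) (x) ... (x) H_(k_n). *)
Definition block_incl (j : 'I_n) : hecke q (k j) -> hecke q (ksum n) :=
  hecke_lift 1 *%R (fun i => hecke_gen q (block_gen i)).

Definition fused_idem : hecke q (ksum n) :=
  \prod_(j < n) @block_incl j (qsymmetriser q (k j)).

Definition fused_hecke : set (hecke q (ksum n)) :=
  range (fun x => fused_idem * x * fused_idem).

Lemma hecke_alg_law m : @alg_law K (hecke q m) 1 *%R.
Proof.
split; [exact: mulrA | exact: mul1r | exact: mulr1 | exact: mulrDl
       | exact: mulrDr | by move=> a x y; rewrite -scalerAl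
       | by move=> a x y; rewrite -scalerAr].
Qed.

Lemma block_gen_relations (j : 'I_n) :
  hecke_relations q 1 *%R (fun i : 'I_(k j).-1 => hecke_gen q (block_gen i)).
Proof.
have [quad braid comm] := hecke_gen_relations q (ksum n).
split=> [i|i i' ii'|i i' ii']; first exact: quad.
- by apply: braid; rewrite /= ii' addnS.
- by apply: comm; rewrite /= -addnS ltn_add2l.
Qed.

Lemma block_inclM j x y : @block_incl j (x * y) = block_incl x * block_incl y.
Proof. exact: (hecke_liftM (hecke_alg_law _) (block_gen_relations j)). Qed.

Variable N : nat.

(* As a space, L_(k_1) (x) ... (x) L_(k_n), inside the tensor power of L_(1). *)
Definition fused_tensor : {vspace tensor_space K N (ksum n)} :=
  limg (hecke_rep N fused_idem).

Definition fused_rep (x : hecke q (ksum n)) : 'End(subvs_of fused_tensor) :=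
  linfun (vsproj fused_tensor \o hecke_rep N x \o vsval).

(* By quantum Schur-Weyl duality this image is the centraliser of U_q(gl_N) on
   [fused_tensor]. *)
Definition fused_hecke_bar : set 'End(subvs_of fused_tensor) :=
  fused_rep @` fused_hecke.

(* [fused_rep] really is a restriction: it involves no truncation. *)
Lemma fused_repE (q_neq0 : q != 0) x u :
  fused_hecke x -> vsval (fused_rep x u) = hecke_rep N x (vsval u).
Proof.
case=> y _ <-; rewrite lfunE /= vsprojK //.
by rewrite -mulrA hecke_repM // comp_lfunE memv_img ?memvf.
Qed.

Lemma fused_repM (q_neq0 : q != 0) x y : fused_hecke x -> fused_hecke y ->
  fused_rep (x * y) = (fused_rep x \o fused_rep y)%VF.
Proof.
move=> Hx Hy; apply/lfunP=> u; apply: val_inj.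
have Hxy : fused_hecke (x * y).
  case: Hx Hy => x' _ <- [y' _ <-].
  by exists (x' * fused_idem * fused_idem * y'); rewrite ?mulrA.
by rewrite comp_lfunE /= !fused_repE // hecke_repM // comp_lfunE.
Qed.

Lemma fused_rep_linear (q_neq0 : q != 0) : linear fused_rep.
Proof.
move=> a x y; apply/lfunP=> u.
rewrite add_lfunE scale_lfunE !lfunE /= hecke_rep_linear //.
by rewrite add_lfunE scale_lfunE linearP.
Qed.

(* [fused_rep] is linear and multiplicative on [fused_hecke] by the lemmas
   above, so it is an isomorphism of algebras as soon as it is bijective. *)
Definition fused_coincide : Prop :=
  set_bij fused_hecke fused_hecke_bar fused_rep.

End Fused.

(* Main.v *)
Require Import Defs.
From mathcomp Require Import all_boot all_order all_algebra.
From mathcomp Require Import reals complex.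
From HB Require Import structures.
From mathcomp Require Import all_fingroup generic_quotient.
From mathcomp Require Import boolp classical_sets.
From mathcomp Require Import zify ring.

Set Implicit Arguments.
Unset Strict Implicit.
Unset Printing Implicit Defensive.

Import GRing.Theory.

Local Open Scope ring_scope.

(** Write m for k_1 + ... + k_n, H for the Hecke algebra on m strands, e for
    the idempotent [fused_idem] and rho for [hecke_rep].  Both directions are
    read off from one basis tensor e_c, whose word c is constant on each of the
    n blocks of positions and takes n decreasing values on them
    ([block_tensor]).  Such a word is available as soon as there are at least n
    letters.

    Suppose n <= N.  The weight space of e_c is the H-module induced from the
    character sigma_i |-> q of the parabolic subalgebra, and e is an element of
    H on which that subalgebra acts from the left by this same character
    ([fused_idem_eigen]).  By Frobenius reciprocity there is a linear map
    [frob_map] from tensors to H which commutes with the action of H and sends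
    e_c to e.  Since rho(e) e_c = e_c, an element y e with rho(y e) e_c = 0
    satisfies rho(y) e_c = 0, hence y e = 0 ([hecke_rep_inj]): evaluation at
    the single vector e_c is already injective on e H e.  The map [frob_map] is
    built by sorting words through adjacent swaps, and its independence of the
    sorting procedure is a diamond-lemma argument which consumes exactly the
    quadratic, braid and commutation relations ([frob_confl], [frobP]).

    The case where all letters of c are distinct is the faithfulness of rho
    for m letters.  It lets products of generators and standard basis elements
    be computed on one basis tensor, which gives Matsumoto's theorem in the
    form of [hecke_std_asc], and from it the eigenvector property of the
    symmetriser and of the antisymmetriser at once ([hecke_gen_symm]).

    Suppose n > N and that all blocks are nonempty.  The antisymmetriser A on
    the first n strands is killed by rho, because a word of N letters has a
    repetition among its first n positions ([rep_antisymm0]).  With n letters,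
    on the other hand, c has a rearrangement t starting with the n letters in
    decreasing order, and e_t = rho(sigma_s) e_c for some word s of generators.
    The matrices of the generators are symmetric, so the coefficient of e_c in
    rho(sigma_(rev s)) z is that of e_t in z.  Hence the coefficient of e_c in
    rho(e sigma_(rev s) A sigma_s e) e_c is that of e_t in rho(A) e_t, which is
    1 ([rep_antisymm_coord]).  So e sigma_(rev s) A sigma_s e is a nonzero
    element of e H e in the kernel of the representation.

    The genericity of q makes the normalisers of the symmetrisers nonzero
    ([poincare_neq0]), and likewise q + q^-1. *)

(** * Inversions and the length of permutations *)

Section Inversions.
Variable m : nat.
Implicit Types (i : 'I_m.-1) (w : 'S_m) (s : seq 'I_m.-1).

Definition ninv w : nat :=
  (\sum_(p : 'I_m * 'I_m) ((p.1 < p.2) && (w p.2 < w p.1)))%N.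

Lemma pos_lo_hi i : pos_lo i != pos_hi i.
Proof. by rewrite -val_eqE /= neq_ltn leqnn. Qed.

Lemma adj_tpermV i : ((adj_tperm i)^-1 = adj_tperm i)%g.
Proof. exact: tpermV. Qed.

Lemma adj_tpermK i w : (adj_tperm i * (adj_tperm i * w) = w)%g.
Proof. by rewrite mulgA -{1}(adj_tpermV i) mulVg mul1g. Qed.

Lemma adj_tperm_lt i (a b : 'I_m) :
  (a, b) != (pos_lo i, pos_hi i) -> (b, a) != (pos_lo i, pos_hi i) ->
  (adj_tperm i a < adj_tperm i b)%N = (a < b)%N.
Proof.
rewrite /adj_tperm !xpair_eqE -!val_eqE /=.
by case: tpermP => [->|->|/eqP + /eqP +]; case: tpermP => [->|->|/eqP + /eqP +];
  rewrite -?val_eqE /=; lia.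
Qed.

(** Simultaneous application of the transposition to both members permutes the
    pairs of positions, and preserves their order except for the swapped pair
    itself, which becomes an inversion. *)
Lemma ninv_adj i w : (w (pos_lo i) < w (pos_hi i))%N ->
  ninv (adj_tperm i * w)%g = (ninv w).+1.
Proof.
move=> w_asc; rewrite /ninv.
pose s2 (p : 'I_m * 'I_m) := (adj_tperm i p.1, adj_tperm i p.2).
have s2K : involutive s2 by case=> a b; rewrite /s2 /= !tpermK.
rewrite (reindex_inj (inv_inj s2K)) /=.
pose lh := (pos_lo i, pos_hi i); pose hl := (pos_hi i, pos_lo i).
have n_lh : hl != lh by rewrite xpair_eqE negb_and eq_sym pos_lo_hi.
rewrite (bigD1 hl) // (bigD1 lh) 1?eq_sym //=.
rewrite [in RHS](bigD1 hl) // [in RHS](bigD1 lh) 1?eq_sym //=.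
rewrite !permM !tpermK {1 2 3 4}/adj_tperm !tpermL !tpermR /= w_asc.
rewrite [(_.+1 < _)%N]ltnNge leqnSn [(w _ < _)%N]ltnNge (ltnW w_asc) ltnSn.
rewrite !andbF !add0n add1n; congr _.+1.
apply: eq_bigr => -[a b] /andP[n_hl n_lh'] /=; rewrite !permM !tpermK.
by rewrite adj_tperm_lt //; apply: contra n_hl; rewrite !xpair_eqE andbC.
Qed.

Lemma ninv_adj_desc i w : (w (pos_hi i) < w (pos_lo i))%N ->
  ninv w = (ninv (adj_tperm i * w)%g).+1.
Proof.
move=> w_desc; rewrite -{1}[w](adj_tpermK i) ninv_adj //.
by rewrite !permM /adj_tperm tpermL tpermR.
Qed.

Lemma perm_lo_hi i w :
  (w (pos_lo i) < w (pos_hi i))%N || (w (pos_hi i) < w (pos_lo i))%N.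
Proof. by rewrite -neq_ltn val_eqE (inj_eq perm_inj) pos_lo_hi. Qed.

Lemma ninv1 : ninv 1%g = 0%N.
Proof. by apply: big1 => -[a b] _ /=; rewrite !perm1; lia. Qed.

Lemma word_perm_cons i s : word_perm (i :: s) = (adj_tperm i * word_perm s)%g.
Proof. by rewrite /word_perm big_cons. Qed.

Lemma ninv_adj_le i w : (ninv (adj_tperm i * w)%g <= (ninv w).+1)%N.
Proof.
case/orP: (perm_lo_hi i w) => [/ninv_adj->//|/ninv_adj_desc->].
by rewrite leqW.
Qed.

Lemma ninv_word s : (ninv (word_perm s) <= size s)%N.
Proof.
elim: s => [|i s IHs]; first by rewrite /word_perm big_nil ninv1.
by rewrite word_perm_cons (leq_trans (ninv_adj_le _ _)).
Qed.

End Inversions.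

(** A multiset of letters has only one weakly decreasing arrangement; this is
    what identifies the end result of sorting a word. *)
Lemma descending_eq m N (t u : {ffun 'I_m -> 'I_N}) :
  (forall i : 'I_m.-1, t (pos_hi i) <= t (pos_lo i))%N ->
  (forall i : 'I_m.-1, u (pos_hi i) <= u (pos_lo i))%N ->
  perm_eq (fgraph t) (fgraph u) -> t = u.
Proof.
have desc (f : {ffun 'I_m -> 'I_N}) :
    (forall i : 'I_m.-1, f (pos_hi i) <= f (pos_lo i))%N ->
    sorted (fun x y : 'I_N => y <= x)%N (fgraph f).
  move=> f_desc; have [->//|[x0 _]] : (fgraph f = [::] :> seq _) \/ exists x : 'I_N, True.
    by case: (tval _) => [|x s]; [left|right; exists x].
  apply/(sortedP x0) => i lt_i.
  have lti : (i < m.-1)%N by rewrite ltn_predRL -[m]card_ord -(size_tuple (fgraph f)).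
  have := f_desc (Ordinal lti).
  by rewrite -!(nth_fgraph_ord x0).
move=> /desc t_s /desc u_s /(sorted_eq _ _ t_s u_s) tu.
apply/(can_inj fgraphK)/val_inj/tu => [y x z|x y].
  by move=> xy yz; apply: leq_trans xy.
by rewrite andbC -eqn_leq => /eqP/val_inj.
Qed.

Lemma perm_eq_fgraph m N (w : 'S_m) (t : {ffun 'I_m -> 'I_N}) :
  perm_eq (fgraph [ffun a => t (w a)]) (fgraph t).
Proof.
have -> : fgraph [ffun a => t (w a)] = map t (map w (enum 'I_m)) :> seq _.
  by rewrite -map_comp fgraph_codom /= codomE; apply: eq_map => a; rewrite ffunE.
rewrite fgraph_codom /= codomE perm_map // uniq_perm ?enum_uniq //.
  by rewrite map_inj_uniq ?enum_uniq //; apply: perm_inj.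
move=> a; rewrite mem_enum; apply/mapP; exists (w^-1%g a); first by rewrite mem_enum.
by rewrite permKV.
Qed.

Section Length.
Variable m : nat.
Implicit Types (i : 'I_m.-1) (w : 'S_m) (s : seq 'I_m.-1).

Lemma perm_descent w : w != 1%g -> exists i, (w (pos_hi i) < w (pos_lo i))%N.
Proof.
move=> w1; apply: boolp.contrapT => /boolp.forallNP w_asc; case/eqP: w1.
pose t := [ffun a : 'I_m => rev_ord (w a)]; pose u := [ffun a : 'I_m => rev_ord a].
suff /ffunP tu : t = u.
  by apply/permP=> a; have := tu a; rewrite !ffunE perm1 => /rev_ord_inj.
apply: descending_eq => [i|i|]; rewrite ?ffunE.
- by have := perm_lo_hi i w; have := w_asc i; rewrite /= => /negP/negPf->; lia.
- by rewrite /=; lia.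
have -> : t = [ffun a => u (w a)] by apply/ffunP=> a; rewrite !ffunE.
exact: perm_eq_fgraph.
Qed.

Lemma ninv_reduced w : exists2 s, word_perm s = w & size s = ninv w.
Proof.
have [d] := ubnP (ninv w); elim: d w => // d IHd w ltd.
have [->|/perm_descent[i w_desc]] := eqVneq w 1%g.
  by exists [::]; rewrite /word_perm ?big_nil ?ninv1.
have ninvE := ninv_adj_desc w_desc.
have [|s Es sizes] := IHd (adj_tperm i * w)%g; first by rewrite -ltnS -ninvE.
by exists (i :: s); rewrite /= ?sizes // word_perm_cons Es adj_tpermK.
Qed.

(** Every letter of a word changes the number of inversions by one, and
    removing descents one at a time writes w with exactly [ninv w] letters. *)
Lemma perm_length_ninv w : perm_length w = ninv w.
Proof.
apply/eqP; rewrite eqn_leq; apply/andP; split.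
  by have [s Es <-] := ninv_reduced w; apply: perm_length_min.
by rewrite -size_reduced_word -{1}[w]reduced_wordP ninv_word.
Qed.

End Length.

(** * The Poincare polynomial of the symmetric group *)

Section Poincare.

(** The value j taken at position 0 is involved in exactly j inversions, one
    for each smaller value. *)
Lemma ninv_lift_perm m (j : 'I_m.+1) (w : 'S_m) :
  ninv (lift_perm ord0 j w) = (j + ninv w)%N.
Proof.
have ninvE r (v : 'S_r) :
    ninv v = (\sum_(a < r) \sum_(b < r) ((a < b) && (v b < v a)))%N.
  by rewrite pair_bigA.
have sum_ltn r (l : nat) : (\sum_(b < r) (b < l) = minn r l)%N.
  by elim: r => [|r IHr]; rewrite ?big_ord0 ?big_ord_recr /= ?IHr; lia.
rewrite !ninvE big_ord_recl big_ord_recl /= add0n; congr (_ + _)%N.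
  under eq_bigr do rewrite lift_perm_id lift_perm_lift /=.
  transitivity (\sum_(b < m) (bump j b < j))%N.
    by rewrite [RHS](reindex_inj (@perm_inj _ w)).
  rewrite -[RHS](minn_idPr (leq_ord j)) -sum_ltn; apply: eq_bigr => b _.
  by rewrite /bump; lia.
apply: eq_bigr => a _; rewrite big_ord_recl /= add0n; apply: eq_bigr => b _.
by rewrite !lift_perm_lift /= !ltnNge !leq_bump2 negbK.
Qed.

Variables (K : fieldType) (x : K).
(** A permutation is determined by its value at 0 and by the relative order of
    its other values. *)
Lemma poincare_factor m :
  \sum_(w : 'S_m) x ^+ ninv w = \prod_(i < m) \sum_(j < i.+1) x ^+ j.
Proof.
elim: m => [|m IHm].
  rewrite big_ord0 (eq_bigl (pred1 1%g)) ?big_pred1_eq ?ninv1 // => w.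
  by apply/esym/eqP/permP=> -[].
pose h (p : 'I_m.+1 * 'S_m) := lift_perm ord0 p.1 p.2.
have h_inj : injective h.
  move=> [j w] [j' w'] /permP hE.
  have := hE ord0; rewrite !lift_perm_id /= => Ej; rewrite -{}Ej in hE *.
  congr pair; apply/permP=> a; have := hE (lift ord0 a).
  by rewrite !lift_perm_lift => /lift_inj.
have h_bij : bijective h.
  by apply: (inj_card_bij h_inj); rewrite card_prod !card_Sn card_ord factS.
rewrite (reindex h) /=; last exact: onW_bij.
rewrite big_ord_recr -IHm /= mulrC mulr_suml.
rewrite -(pair_bigA _ (fun j w => x ^+ ninv (h (j, w)))) /=.
apply: eq_bigr => j _; rewrite mulr_sumr; apply: eq_bigr => w _.
by rewrite ninv_lift_perm exprD.
Qed.

(** A vanishing factor 1 + x + ... + x^i would make x an (i+1)-st root of unity,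
    hence x = 1, but then the factor is i + 1. *)
Lemma poincare_neq0 (char0 : forall i, i.+1%:R != 0 :> K)
    (x_generic : forall i, (0 < i)%N -> x ^+ i = 1 -> x = 1) m :
  \sum_(w : 'S_m) x ^+ ninv w != 0.
Proof.
rewrite poincare_factor; apply/prodf_neq0 => i _.
apply: contraTneq (char0 i) => sum0; rewrite negbK.
have /x_generic x1 : x ^+ i.+1 = 1.
  by apply/eqP; rewrite -subr_eq0 subrX1 sum0 mulr0.
rewrite -sum0 -[X in X%:R]card_ord -sumr_const; apply/eqP/eq_bigr => j _.
by rewrite x1 // expr1n.
Qed.

End Poincare.

(** * Generators of the Hecke algebra and their action on tensors *)

Section HeckeFacts.
Variables (K : fieldType) (q : K) (m : nat).
Implicit Types (i j : 'I_m.-1) (x y : hecke q m).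

Lemma hecke_ind (P : hecke q m -> Prop) :
  (forall i, P (hecke_gen q i)) -> (forall a, P a%:A) ->
  (forall x y, P x -> P y -> P (x + y)) ->
  (forall x y, P x -> P y -> P (x * y)) -> forall x, P x.
Proof.
move=> Pgen Pscal Padd Pmul; elim/quotW; elim=> [i|a|t Pt u Pu|t Pt u Pu].
- exact: Pgen.
- suff -> : (\pi_(hecke q m) (HScal a))%qT = a%:A by [].
  exact/esym/hecke_mul1r.
- rewrite -[X in P X]hecke_addE; exact: Padd.
- rewrite -[X in P X]hecke_mulE; exact: Pmul.
Qed.

Lemma hecke_quad i :
  hecke_gen q i * hecke_gen q i = (q - q^-1) *: hecke_gen q i + 1.
Proof. exact: (hecke_rel_quad (hecke_gen_relations q m)). Qed.

Lemma hecke_braid i j : j = i.+1 :> nat ->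
  hecke_gen q i * (hecke_gen q j * hecke_gen q i) =
  hecke_gen q j * (hecke_gen q i * hecke_gen q j).
Proof.
by move=> ij; rewrite !mulrA (hecke_rel_braid (hecke_gen_relations q m)).
Qed.

Lemma hecke_braid_act i j x : j = i.+1 :> nat ->
  hecke_gen q i * (hecke_gen q j * (hecke_gen q i * x)) =
  hecke_gen q j * (hecke_gen q i * (hecke_gen q j * x)).
Proof. by move=> ij; have := congr1 ( *%R^~ x) (hecke_braid ij); rewrite /= -!mulrA. Qed.

Lemma hecke_comm i j : (i.+1 < j)%N ->
  hecke_gen q i * hecke_gen q j = hecke_gen q j * hecke_gen q i.
Proof. exact: (hecke_rel_comm (hecke_gen_relations q m)). Qed.

Lemma hecke_word_cons i s : hecke_word q (i :: s) = hecke_gen q i * hecke_word q s.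
Proof. exact: big_cons. Qed.

Lemma hecke_word_nil : hecke_word q [::] = 1 :> hecke q m.
Proof. exact: big_nil. Qed.

End HeckeFacts.

Section Action.
Variables (K : fieldType) (q : K) (q_neq0 : q != 0) (N m : nat).
Implicit Types (i : 'I_m.-1) (t u : {ffun 'I_m -> 'I_N}).
Implicit Types (z : tensor_space K N m).

Notation e_ := (tensor_basis K).

Lemma Rcheck_eq i t : t (pos_lo i) = t (pos_hi i) -> Rcheck q N i (e_ t) = q *: e_ t.
Proof. by move=> Et; rewrite Rcheck_tensor_basis /Rcheck_basis Et eqxx. Qed.

Lemma Rcheck_desc i t : (t (pos_hi i) < t (pos_lo i))%N ->
  Rcheck q N i (e_ t) = e_ (tensor_swap i t).
Proof.
move=> t_desc; rewrite Rcheck_tensor_basis /Rcheck_basis -val_eqE gtn_eqF //.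
by rewrite ltnNge ltnW.
Qed.

Lemma Rcheck_asc i t : (t (pos_lo i) < t (pos_hi i))%N ->
  Rcheck q N i (e_ t) = e_ (tensor_swap i t) + (q - q^-1) *: e_ t.
Proof.
by move=> t_asc; rewrite Rcheck_tensor_basis /Rcheck_basis t_asc -val_eqE ltn_eqF.
Qed.

Lemma tensor_basis_coord t u : e_ t u = (u == t)%:R.
Proof. by rewrite ffunE. Qed.

Lemma tensor_swap_eq i t u : (tensor_swap i t == u) = (t == tensor_swap i u).
Proof. by apply/eqP/eqP => [<-|->]; rewrite tensor_swapK. Qed.

(** The symmetry of these matrices turns the action on basis tensors into an
    action on coordinates, with the same three cases. *)
Lemma Rcheck_sym i t u : Rcheck q N i (e_ t) u = Rcheck q N i (e_ u) t.
Proof.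
rewrite !Rcheck_tensor_basis.
have [->//|ntu] := eqVneq t u.
have offdiag t' u' : t' != u' ->
    Rcheck_basis q i t' u' =
    if t' (pos_lo i) == t' (pos_hi i) then 0 else (u' == tensor_swap i t')%:R.
  move=> ntu'; rewrite /Rcheck_basis; case: ifP => _.
    by rewrite !ffunE eq_sym (negPf ntu') scaler0.
  by case: ifP => _; rewrite !ffunE // [u' == t']eq_sym (negPf ntu') scaler0 addr0.
have nut : u != t by rewrite eq_sym.
rewrite (offdiag _ _ ntu) (offdiag _ _ nut) -(tensor_swap_eq i t u) [_ == u]eq_sym.
have [->|] := eqVneq u (tensor_swap i t); last by rewrite !if_same.
by rewrite tensor_swap_lo tensor_swap_hi eq_sym.
Qed.

Lemma Rcheck_coord i z u : Rcheck q N i z u = \sum_t z t * Rcheck q N i (e_ u) t.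
Proof.
rewrite {1}[z]tensor_basisE linear_sum sum_ffunE; apply: eq_bigr => t _.
by rewrite linearZ ffunE /GRing.scale /= Rcheck_sym.
Qed.

Lemma sum_tensor_basis z u : \sum_t z t * e_ u t = z u.
Proof.
rewrite (bigD1 u) //= big1 => [|t ntu]; rewrite tensor_basis_coord.
  by rewrite eqxx mulr1 addr0.
by rewrite (negPf ntu) mulr0.
Qed.

Lemma Rcheck_coord_eq i z u : u (pos_lo i) = u (pos_hi i) ->
  Rcheck q N i z u = q * z u.
Proof.
move=> Eu; rewrite Rcheck_coord Rcheck_eq // -sum_tensor_basis mulr_sumr.
by apply: eq_bigr => t _; rewrite ffunE /GRing.scale /= mulrCA.
Qed.

Lemma Rcheck_coord_desc i z u : (u (pos_hi i) < u (pos_lo i))%N ->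
  Rcheck q N i z u = z (tensor_swap i u).
Proof. by move=> u_desc; rewrite Rcheck_coord Rcheck_desc // sum_tensor_basis. Qed.

Lemma Rcheck_coord_asc i z u : (u (pos_lo i) < u (pos_hi i))%N ->
  Rcheck q N i z u = z (tensor_swap i u) + (q - q^-1) * z u.
Proof.
move=> u_asc; rewrite Rcheck_coord Rcheck_asc // -!sum_tensor_basis mulr_sumr.
rewrite -big_split.
by apply: eq_bigr => t _; rewrite /= !ffunE /GRing.scale /= mulrDr mulrCA.
Qed.

End Action.

Section RepLinear.
Variables (K : fieldType) (q : K) (q_neq0 : q != 0) (N m : nat).
Implicit Types (x y : hecke q m).

Let law := @comp_lfun_alg_law K N m.
Let rel := Rcheck_relations N m q_neq0.

Lemma hecke_repD x y : hecke_rep N (x + y) = hecke_rep N x + hecke_rep N y.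
Proof. exact: (hecke_liftD law rel). Qed.

Lemma hecke_repZ a x : hecke_rep N (a *: x) = a *: hecke_rep N x.
Proof. exact: (hecke_liftZ law rel). Qed.

Lemma hecke_rep0 : hecke_rep N (0 : hecke q m) = 0.
Proof. by rewrite -(scale0r (0 : hecke q m)) hecke_repZ scale0r. Qed.

Lemma hecke_rep_sum (I : finType) (F : I -> hecke q m) :
  hecke_rep N (\sum_i F i) = \sum_i hecke_rep N (F i).
Proof. exact: (big_morph _ hecke_repD hecke_rep0). Qed.

End RepLinear.

(** * Adjacent swaps of words *)

Section Swaps.
Variables (N m : nat).
Implicit Types (i j : 'I_m.-1) (t u : {ffun 'I_m -> 'I_N}).

Lemma tensor_swap_out i t a :
  a != pos_lo i -> a != pos_hi i -> tensor_swap i t a = t a.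
Proof. by move=> nlo nhi; rewrite ffunE /adj_tperm tpermD // eq_sym. Qed.

Definition far i j := (i.+1 < j)%N || (j.+1 < i)%N.

Lemma far_sym i j : far i j = far j i. Proof. exact: orbC. Qed.

Lemma tensor_swap_lo_far i j t : far i j -> tensor_swap j t (pos_lo i) = t (pos_lo i).
Proof. by rewrite /far => ij; apply: tensor_swap_out; rewrite -val_eqE /=; lia. Qed.

Lemma tensor_swap_hi_far i j t : far i j -> tensor_swap j t (pos_hi i) = t (pos_hi i).
Proof. by rewrite /far => ij; apply: tensor_swap_out; rewrite -val_eqE /=; lia. Qed.

Lemma tensor_swap_comm i j t : far i j ->
  tensor_swap i (tensor_swap j t) = tensor_swap j (tensor_swap i t).
Proof.
move=> ij; apply/ffunP=> a; rewrite !ffunE -!permM; congr (t _).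
have ffix x : (x == pos_lo j) || (x == pos_hi j) -> adj_tperm i x = x.
  by rewrite /far in ij; case/orP=> /eqP->; rewrite /adj_tperm tpermD // -val_eqE /=; lia.
suff -> : (adj_tperm i * adj_tperm j = adj_tperm j * adj_tperm i)%g by [].
rewrite [RHS]conjgC; congr (_ * _)%g.
by rewrite {2}/adj_tperm tpermJ !ffix ?eqxx ?orbT.
Qed.

(** The termination measure for sorting a word by adjacent swaps. *)
Definition moment t : nat := (\sum_(a < m) a * t a)%N.

Lemma moment_swap i t : (t (pos_lo i) < t (pos_hi i))%N ->
  (moment (tensor_swap i t) < moment t)%N.
Proof.
move=> t_asc; pose rest u := (\sum_(a | (a != pos_lo i) && (a != pos_hi i)) a * u a)%N.
have momentE u : moment u = (i * u (pos_lo i) + (i.+1 * u (pos_hi i) + rest u))%N.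
  by rewrite /moment (bigD1 (pos_lo i)) // (bigD1 (pos_hi i)) // eq_sym pos_lo_hi.
rewrite !momentE tensor_swap_lo tensor_swap_hi.
have -> : rest (tensor_swap i t) = rest t.
  by apply: eq_bigr => a /andP[n1 n2]; rewrite ffunE /adj_tperm tpermD // eq_sym.
by rewrite !mulSn; move: (i * _)%N (i * _)%N (rest t) t_asc; lia.
Qed.

Variables (i j : 'I_m.-1) (ij : j = i.+1 :> nat).

Lemma pos_lo_succ : pos_lo j = pos_hi i. Proof. exact: val_inj. Qed.

Lemma tensor_swap_succ t :
  [/\ tensor_swap i t (pos_hi j) = t (pos_hi j),
      tensor_swap j t (pos_lo i) = t (pos_lo i),
      tensor_swap j t (pos_hi i) = t (pos_hi j) &
      tensor_swap j t (pos_hi j) = t (pos_hi i)].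
Proof.
split; last 2 first.
- by rewrite -pos_lo_succ tensor_swap_lo.
- by rewrite tensor_swap_hi pos_lo_succ.
- by apply: tensor_swap_out; rewrite -val_eqE /=; lia.
- by apply: tensor_swap_out; rewrite -val_eqE /=; lia.
Qed.

Lemma tensor_swap_braid t :
  tensor_swap i (tensor_swap j (tensor_swap i t)) =
  tensor_swap j (tensor_swap i (tensor_swap j t)).
Proof.
have n01 := pos_lo_hi i.
have n02 : pos_lo i != pos_hi j by rewrite -val_eqE /=; lia.
have n12 : pos_hi i != pos_hi j by rewrite -val_eqE /=; lia.
apply/ffunP=> a; rewrite !ffunE /adj_tperm pos_lo_succ; congr (t _).
set si := tperm (pos_lo i) _; set sj := tperm (pos_hi i) _.
suff /permP/(_ a) : (si * sj * si = sj * si * sj)%g by rewrite !permM.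
rewrite -{1}[si]tpermV -{2}[sj]tpermV -/si -/sj -2!mulgA -!conjgE !tpermJ.
by rewrite tpermL tpermR !tpermD // eq_sym.
Qed.

End Swaps.

(** * Frobenius reciprocity by sorting words *)

Section Frobenius.
Variables (K : fieldType) (q : K) (q_neq0 : q != 0) (N m : nat).
Implicit Types (i j : 'I_m.-1) (t u : {ffun 'I_m -> 'I_N}).

Variables (c : {ffun 'I_m -> 'I_N}) (m0 : hecke q m).
Hypothesis m0_eq : forall i, c (pos_lo i) = c (pos_hi i) ->
  hecke_gen q i * m0 = q *: m0.

(** The image of the basis tensor of t: sort t into decreasing order by swaps,
    multiply by the corresponding generators, and start from m0 at c.  A word
    which is not a rearrangement of c gets 0.  The argument d is fuel, for
    which the moment of t suffices. *)
Fixpoint frob_rec d t : hecke q m :=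
  if [pick i | (t (pos_lo i) < t (pos_hi i))%N] is Some i then
    if d is d'.+1 then hecke_gen q i * frob_rec d' (tensor_swap i t) else 0
  else if t == c then m0 else 0.

Definition frob t := frob_rec (moment t) t.

Lemma frob_fuel d t : (moment t <= d)%N -> frob_rec d t = frob t.
Proof.
rewrite /frob; have [e] := ubnP d.
elim: e d t => // e IHe [|d] t; rewrite ltnS => led.
  by rewrite leqn0 => /eqP->.
move=> le_d; case Em: (moment t) => [|d'] /=; case: pickP => // i t_asc.
  by have := moment_swap t_asc; rewrite Em.
have := moment_swap t_asc; rewrite Em ltnS => lem.
by rewrite !IHe //; lia.
Qed.

Lemma frob_asc_pick t : (exists i, t (pos_lo i) < t (pos_hi i))%N ->
  exists2 i, (t (pos_lo i) < t (pos_hi i))%N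
           & frob t = hecke_gen q i * frob (tensor_swap i t).
Proof.
case=> i0 t_asc0; rewrite {1}/frob; have := moment_swap t_asc0.
case Em: (moment t) => [|d] //= _.
case: pickP => [i t_asc|/(_ i0)]; last by rewrite t_asc0.
by exists i => //; rewrite frob_fuel //; have := moment_swap t_asc; rewrite Em ltnS.
Qed.

Lemma frob_desc t : (forall i, t (pos_hi i) <= t (pos_lo i))%N ->
  frob t = if t == c then m0 else 0.
Proof.
move=> t_desc; rewrite /frob.
case: (moment t) => [|d] /=; case: pickP => // i; by rewrite ltnNge t_desc.
Qed.

(** These two local rules make [frob] equivariant: a descent of t is an ascent
    of the swapped word, and the quadratic relation then gives the action of a
    generator at an ascent. *)
Definition frob_good t :=
  (forall i, (t (pos_lo i) < t (pos_hi i))%N ->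
     frob t = hecke_gen q i * frob (tensor_swap i t)) /\
  (forall i, t (pos_lo i) = t (pos_hi i) ->
     hecke_gen q i * frob t = q *: frob t).

Lemma hecke_comm_far i j : far i j ->
  hecke_gen q i * hecke_gen q j = hecke_gen q j * hecke_gen q i.
Proof. by case/orP => /hecke_comm->. Qed.

(** The diamond lemma.  Two ascents at distant positions are resolved in two
    steps by the commutation relation, and two adjacent ones, where the word
    has three increasing letters in a row, in three steps by the braid
    relation. *)
Lemma frob_confl t i j :
  (forall u, (moment u < moment t)%N -> frob_good u) ->
  (t (pos_lo i) < t (pos_hi i))%N -> (t (pos_lo j) < t (pos_hi j))%N ->
  hecke_gen q i * frob (tensor_swap i t) = hecke_gen q j * frob (tensor_swap j t).
Proof.
move=> IH; wlog le_ij : i j / (i <= j)%N.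
  move=> IHij; have [le_ij|lt_ji] := leqP i j; first exact: IHij.
  by move=> t_i t_j; apply/esym/IHij => //; apply: ltnW.
move=> t_i t_j.
have [goodi _] := IH _ (moment_swap t_i); have [goodj _] := IH _ (moment_swap t_j).
case: (ltngtP i.+1 j) => [ij||ij].
- have fij : far i j by rewrite /far ij.
  have fji : far j i by rewrite far_sym.
  rewrite (goodi j) ?(goodj i) ?tensor_swap_lo_far ?tensor_swap_hi_far //.
  by rewrite !mulrA hecke_comm_far // tensor_swap_comm.
- by rewrite ltnS leq_eqVlt ltnNge le_ij orbF => /eqP/val_inj->.
have [ijhj jlo jhi jhj] := tensor_swap_succ (esym ij) t.
have [_ ijlo ijhi _] := tensor_swap_succ (esym ij) (tensor_swap i t).
have [jihj _ _ _] := tensor_swap_succ (esym ij) (tensor_swap j t).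
have lo := pos_lo_succ (esym ij).
have Eilo := tensor_swap_lo i t; have Eihi := tensor_swap_hi i t.
have Ejihi := tensor_swap_hi i (tensor_swap j t).
rewrite lo in t_j.
have a1 : (tensor_swap i t (pos_lo j) < tensor_swap i t (pos_hi j))%N.
  by rewrite lo Eihi ijhj; lia.
have a2 : (tensor_swap j t (pos_lo i) < tensor_swap j t (pos_hi i))%N.
  by rewrite jlo jhi; lia.
have m1 := ltn_trans (moment_swap a1) (moment_swap t_i).
have t_j' : (t (pos_lo j) < t (pos_hi j))%N by rewrite lo.
have m2 := ltn_trans (moment_swap a2) (moment_swap t_j').
have [good1 _] := IH _ m1; have [good2 _] := IH _ m2.
rewrite (goodi j) // (goodj i) // (good1 i) ?(good2 j).
- by rewrite tensor_swap_braid // hecke_braid_act.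
- by rewrite lo Ejihi jihj jhj jlo; lia.
- by rewrite ijlo ijhi Eilo ijhj; lia.
Qed.

(** For equal letters at i: if t is weakly decreasing then it is c, or else its
    image is 0.  Otherwise move to a smaller word by an ascent j.  When j is
    adjacent to i, the letters have the form (a, a, b) or (a, b, b) with a < b,
    and the braid relation transports the eigenvector property from the word
    where the two equal letters have moved together past the third one. *)
Lemma frobP t : frob_good t.
Proof.
have [d] := ubnP (moment t); elim: d t => // d IHd t; rewrite ltnS => led.
have IH u : (moment u < moment t)%N -> frob_good u.
  by move=> ltu; apply: IHd; apply: leq_trans led.
have good1 i : (t (pos_lo i) < t (pos_hi i))%N ->
    frob t = hecke_gen q i * frob (tensor_swap i t).
  move=> t_i; have [j t_j ->] := frob_asc_pick (ex_intro _ i t_i).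
  exact: frob_confl.
split=> // i Ei.
have [t_desc|[j t_j]] : (forall j, t (pos_hi j) <= t (pos_lo j))%N \/
    exists j, (t (pos_lo j) < t (pos_hi j))%N.
  case: (pickP (fun j => t (pos_lo j) < t (pos_hi j)))%N => [j t_j|no].
    by right; exists j.
  by left=> j; rewrite leqNgt no.
  rewrite frob_desc //; case: eqP => [tc|_]; last by rewrite mulr0 scaler0.
  by apply: m0_eq; rewrite -tc.
rewrite (good1 j t_j); have [asc_u eq_u] := IH _ (moment_swap t_j).
have [fij|] := boolP (far i j).
  have fji : far j i by rewrite far_sym.
  rewrite mulrA hecke_comm_far // -mulrA eq_u ?scalerAr //.
  by rewrite tensor_swap_lo_far // tensor_swap_hi_far.
rewrite /far negb_or -!leqNgt => /andP[ji ij].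
case: (ltngtP i j) => [lt_ij|lt_ji|/val_inj Eij]; last by rewrite -Eij Ei ltnn in t_j.
- have Ej : j = i.+1 :> nat by lia.
  have [_ jlo jhi jhj] := tensor_swap_succ Ej t.
  have [ihj _ _ _] := tensor_swap_succ Ej (tensor_swap j t).
  have lo := pos_lo_succ Ej.
  have a : (tensor_swap j t (pos_lo i) < tensor_swap j t (pos_hi i))%N.
    by rewrite jlo jhi Ei -lo.
  have [_ eq_v] := IH _ (ltn_trans (moment_swap a) (moment_swap t_j)).
  rewrite (asc_u i a) hecke_braid_act // eq_v -?scalerAr //.
  by rewrite ihj lo tensor_swap_hi jlo jhj.
- have Ej : i = j.+1 :> nat by lia.
  have [_ jlo jhi jhj] := tensor_swap_succ Ej (tensor_swap j t).
  have [ihj _ _ _] := tensor_swap_succ Ej t.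
  have lo := pos_lo_succ Ej.
  have a : (tensor_swap j t (pos_lo i) < tensor_swap j t (pos_hi i))%N.
    by rewrite lo tensor_swap_hi ihj -Ei lo.
  have [_ eq_v] := IH _ (ltn_trans (moment_swap a) (moment_swap t_j)).
  rewrite (asc_u i a) -hecke_braid_act // eq_v -?scalerAr //.
  by rewrite jlo jhi ihj tensor_swap_lo -lo Ei.
Qed.

Definition frob_map (z : tensor_space K N m) : hecke q m := \sum_t (z t : K) *: frob t.

Lemma frob_map_is_linear : linear frob_map.
Proof.
move=> a x y; rewrite /frob_map scaler_sumr -big_split /=.
by apply: eq_bigr => t _; rewrite !ffunE scalerDl scalerA.
Qed.

HB.instance Definition _ :=
  GRing.isLinear.Build K (tensor_space K N m) (hecke q m) *:%R frob_map
    frob_map_is_linear.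

Lemma frob_map_basis t : frob_map (tensor_basis K t) = frob t.
Proof.
rewrite /frob_map (bigD1 t) //= big1 => [|u nut].
  by rewrite tensor_basis_coord eqxx scale1r addr0.
by rewrite tensor_basis_coord (negPf nut) scale0r.
Qed.

Lemma frob_map_gen i z : frob_map (Rcheck q N i z) = hecke_gen q i * frob_map z.
Proof.
rewrite [z]tensor_basisE !linear_sum mulr_sumr; apply: eq_bigr => t _.
rewrite !linearZ -scalerAr /=; congr (_ *: _); rewrite frob_map_basis.
have [asc_t eq_t] := frobP t.
case: (ltngtP (t (pos_lo i)) (t (pos_hi i))) => [t_i|t_i|/val_inj t_i].
- rewrite Rcheck_asc // linearD linearZ /= !frob_map_basis (asc_t i) //.
  by rewrite mulrA hecke_quad mulrDl mul1r -scalerAl addrC.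
- rewrite Rcheck_desc // frob_map_basis.
  have [asc_u _] := frobP (tensor_swap i t).
  by rewrite (asc_u i) ?tensor_swapK // tensor_swap_lo tensor_swap_hi.
- by rewrite Rcheck_eq // linearZ /= frob_map_basis eq_t.
Qed.

Lemma frob_map_act x z : frob_map (hecke_rep N x z) = x * frob_map z.
Proof.
elim/hecke_ind: x z => [i z|a z|x y IHx IHy z|x y IHx IHy z].
- by rewrite hecke_rep_gen // frob_map_gen.
- by rewrite hecke_repZ // hecke_rep1 // scale_lfunE id_lfunE linearZ -scalerAl mul1r.
- by rewrite hecke_repD // add_lfunE linearD /= IHx IHy mulrDl.
- by rewrite hecke_repM // comp_lfunE IHx IHy mulrA.
Qed.

Hypothesis c_desc : forall i, (c (pos_hi i) <= c (pos_lo i))%N.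

(** The value of x at e_c determines x * m0, because [frob_map] sends it there. *)
Lemma hecke_rep_inj x : hecke_rep N x (tensor_basis K c) = 0 -> x * m0 = 0.
Proof.
move=> x0; have := frob_map_act x (tensor_basis K c).
by rewrite x0 linear0 frob_map_basis frob_desc ?eqxx.
Qed.

End Frobenius.

(** * Embeddings of Hecke algebras on consecutive strands *)

Section Shift.
Variables (K : fieldType) (q : K) (q_neq0 : q != 0) (p r m : nat).
Variables (f : 'I_r.-1 -> 'I_m.-1) (g : 'I_r -> 'I_m).
Hypothesis fE : forall i, f i = (p + i)%N :> nat.
Hypothesis gE : forall a, g a = (p + a)%N :> nat.

Lemma shift_lo i : g (pos_lo i) = pos_lo (f i).
Proof. by apply: val_inj; rewrite /= gE fE. Qed.

Lemma shift_hi i : g (pos_hi i) = pos_hi (f i).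
Proof. by apply: val_inj; rewrite /= gE fE addnS. Qed.

Lemma shift_inj : injective g.
Proof. by move=> a b /(congr1 val) /=; rewrite !gE => /addnI/val_inj. Qed.

(** Along a reduced word each generator swaps two letters in decreasing order,
    so that no correction term appears. *)
Lemma rep_reduced_word N (t : {ffun 'I_m -> 'I_N}) :
  (forall a b : 'I_r, (a < b)%N -> (t (g b) < t (g a))%N) ->
  forall s, size s = ninv (word_perm s) ->
  exists2 u, hecke_rep N (hecke_word q (map f s)) (tensor_basis K t) = tensor_basis K u
           & forall a, u (g a) = t (g (word_perm s a)).
Proof.
move=> t_desc; elim=> [|i s IHs] reduced_s.
  exists t => [|a]; first by rewrite hecke_word_nil hecke_rep1 // id_lfunE.
  by rewrite /word_perm big_nil perm1.
rewrite word_perm_cons /= in reduced_s.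
have asc : (word_perm s (pos_lo i) < word_perm s (pos_hi i))%N.
  case/orP: (perm_lo_hi i (word_perm s)) => // /ninv_adj_desc.
  by have := ninv_word s; lia.
have [|u rho_u u_g] := IHs; first by move: reduced_s; rewrite ninv_adj // => -[].
exists (tensor_swap (f i) u) => [|a].
  rewrite hecke_word_cons hecke_repM // comp_lfunE hecke_rep_gen // rho_u.
  by rewrite Rcheck_desc // -shift_lo -shift_hi !u_g t_desc.
rewrite word_perm_cons permM -u_g ffunE; congr (u _).
have [->|n_lo] := eqVneq a (pos_lo i).
  by rewrite /adj_tperm shift_lo !tpermL shift_hi.
have [->|n_hi] := eqVneq a (pos_hi i).
  by rewrite /adj_tperm shift_hi !tpermR shift_lo.
by rewrite /adj_tperm !tpermD // -?shift_lo -?shift_hi ?(inj_eq shift_inj) // eq_sym.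
Qed.

Definition hecke_shift : hecke q r -> hecke q m :=
  hecke_lift 1 *%R (fun i => hecke_gen q (f i)).

Lemma shift_relations :
  hecke_relations q 1 *%R (fun i : 'I_r.-1 => hecke_gen q (f i)).
Proof.
have [quad braid comm] := hecke_gen_relations q m.
split=> [i|i i' ii'|i i' ii']; first exact: quad.
- by apply: braid; rewrite !fE ii' addnS.
- by apply: comm; rewrite !fE -addnS ltn_add2l.
Qed.

Let law := hecke_alg_law q m.
Let rel := shift_relations.

Lemma hecke_shift_gen i : hecke_shift (hecke_gen q i) = hecke_gen q (f i).
Proof. exact: (hecke_lift_gen law rel). Qed.

Lemma hecke_shift1 : hecke_shift 1 = 1.
Proof. exact: (hecke_lift1 law rel). Qed.

Lemma hecke_shiftD x y : hecke_shift (x + y) = hecke_shift x + hecke_shift y.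
Proof. exact: (hecke_liftD law rel). Qed.

Lemma hecke_shiftM x y : hecke_shift (x * y) = hecke_shift x * hecke_shift y.
Proof. exact: (hecke_liftM law rel). Qed.

Lemma hecke_shiftZ a x : hecke_shift (a *: x) = a *: hecke_shift x.
Proof. exact: (hecke_liftZ law rel). Qed.

Lemma hecke_shift0 : hecke_shift 0 = 0.
Proof. by rewrite -(scale0r (0 : hecke q r)) hecke_shiftZ scale0r. Qed.

Lemma hecke_shift_word s : hecke_shift (hecke_word q s) = hecke_word q (map f s).
Proof.
elim: s => [|i s IHs]; first by rewrite /= !hecke_word_nil hecke_shift1.
by rewrite /= !hecke_word_cons hecke_shiftM hecke_shift_gen IHs.
Qed.

Lemma hecke_shift_comm x i : (forall j, far i (f j)) ->
  hecke_gen q i * hecke_shift x = hecke_shift x * hecke_gen q i.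
Proof.
move=> far_i; elim/hecke_ind: x => [j|a|x y Ex Ey|x y Ex Ey].
- by rewrite hecke_shift_gen hecke_comm_far.
- by rewrite hecke_shiftZ hecke_shift1 -scalerAr -scalerAl mulr1 mul1r.
- by rewrite hecke_shiftD mulrDl mulrDr Ex Ey.
- by rewrite hecke_shiftM mulrA Ex -mulrA Ey mulrA.
Qed.

End Shift.

(** * Standard basis, symmetriser and antisymmetriser *)

Section Regular.
Variables (K : fieldType) (q : K) (q_neq0 : q != 0) (m : nat).
Implicit Types (i : 'I_m.-1) (w : 'S_m) (s : seq 'I_m.-1).

Definition rev_tensor w : {ffun 'I_m -> 'I_m} := [ffun a => rev_ord (w a)].

(** Frobenius reciprocity for the trivial parabolic subalgebra: no two letters
    are equal, so any element, in particular 1, may be prescribed. *)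
Lemma hecke_rep_regular_inj (x : hecke q m) :
  hecke_rep m x (tensor_basis K (rev_tensor 1%g)) = 0 -> x = 0.
Proof.
rewrite -[in X in _ -> X](mulr1 x); apply: hecke_rep_inj => // i.
  rewrite !ffunE !perm1 => /rev_ord_inj/eqP; by rewrite (negPf (pos_lo_hi i)).
by rewrite !ffunE !perm1 /=; lia.
Qed.

Lemma hecke_rep_reduced s : size s = ninv (word_perm s) ->
  hecke_rep m (hecke_word q s) (tensor_basis K (rev_tensor 1%g)) =
  tensor_basis K (rev_tensor (word_perm s)).
Proof.
case/(@rep_reduced_word K q q_neq0 0 m m id id (fun=> erefl) (fun=> erefl) m
  (rev_tensor 1%g)).
  by move=> a b ab; rewrite !ffunE !perm1 /=; have := ltn_ord b; lia.
move=> u; rewrite map_id => -> Eu; congr tensor_basis; apply/ffunP=> a.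
by rewrite Eu !ffunE perm1.
Qed.

Lemma reduced_word_ninv w : size (reduced_word w) = ninv (word_perm (reduced_word w)).
Proof. by rewrite size_reduced_word reduced_wordP perm_length_ninv. Qed.

Lemma hecke_rep_std w :
  hecke_rep m (hecke_std q w) (tensor_basis K (rev_tensor 1%g)) =
  tensor_basis K (rev_tensor w).
Proof.
by rewrite hecke_rep_reduced ?reduced_wordP ?reduced_word_ninv // reduced_wordP.
Qed.

(** Both sides have the same value at a tensor where evaluation is injective. *)
Lemma hecke_std_asc i w : (w (pos_lo i) < w (pos_hi i))%N ->
  hecke_gen q i * hecke_std q w = hecke_std q (adj_tperm i * w)%g.
Proof.
move=> asc; apply/eqP; rewrite -subr_eq0; apply/eqP/hecke_rep_regular_inj.
rewrite -scaleN1r hecke_repD // hecke_repZ // add_lfunE scale_lfunE.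
rewrite hecke_repM // comp_lfunE !hecke_rep_std hecke_rep_gen // Rcheck_desc.
  rewrite scaleN1r -[X in _ - tensor_basis _ X]/(rev_tensor _).
  apply/eqP; rewrite subr_eq0; apply/eqP; congr tensor_basis; apply/ffunP=> a.
  by rewrite !ffunE permM.
by rewrite !ffunE /=; have := ltn_ord (w (pos_hi i)); lia.
Qed.

Variables (lam : K) (lam_quad : lam * lam = (q - q^-1) * lam + 1).

(** For lam = q this is the symmetriser up to a scalar, for lam = - q^-1 the
    antisymmetriser: these are the two roots of the quadratic relation. *)
Definition hecke_symm : hecke q m := \sum_(w : 'S_m) lam ^+ ninv w *: hecke_std q w.

(** The terms of w and s_i w, where i is an ascent of w, span a subspace stable
    under sigma_i, and the quadratic equation for lam says that their
    combination is an eigenvector. *)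
Lemma hecke_gen_symm i : hecke_gen q i * hecke_symm = lam *: hecke_symm.
Proof.
pose asc w := (w (pos_lo i) < w (pos_hi i))%N.
have adjK : involutive (fun w => adj_tperm i * w)%g by apply: adj_tpermK.
have asc_adj w : asc (adj_tperm i * w)%g = ~~ asc w.
  rewrite /asc !permM /adj_tperm tpermL tpermR.
  by have := perm_lo_hi i w; rewrite -leqNgt; case: ltngtP.
have pairE : hecke_symm = \sum_(w | asc w)
    (lam ^+ ninv w *: hecke_std q w +
     lam ^+ (ninv w).+1 *: hecke_std q (adj_tperm i * w)%g).
  rewrite /hecke_symm (bigID asc) big_split /=; congr (_ + _).
  rewrite (reindex_inj (inv_inj adjK)) /=.
  apply: eq_big => [w|w]; rewrite asc_adj negbK // => asc_w.
  by rewrite ninv_adj.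
rewrite pairE mulr_sumr scaler_sumr; apply: eq_bigr => w asc_w.
rewrite mulrDr -!scalerAr -hecke_std_asc // mulrA hecke_quad mulrDl mul1r -scalerAl.
rewrite !scalerDr !scalerA -!exprS addrCA addrA addrC; congr (_ + _).
by rewrite addrC -scalerDl; congr (_ *: _); rewrite !exprS mulrA lam_quad; ring.
Qed.

End Regular.

Section Symmetriser.
Variables (K : fieldType) (q : K) (q_neq0 : q != 0) (p r m : nat).
Variables (f : 'I_r.-1 -> 'I_m.-1) (fE : forall i, f i = (p + i)%N :> nat).

Lemma quad_q : q * q = (q - q^-1) * q + 1.
Proof. by field. Qed.

Lemma quad_Vq : - q^-1 * - q^-1 = (q - q^-1) * - q^-1 + 1.
Proof. by field. Qed.

Lemma qsymmetriserE :
  qsymmetriser q r = (\sum_(w : 'S_r) (q ^+ 2) ^+ ninv w)^-1 *: hecke_symm q r q.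
Proof.
congr (_^-1 *: _); apply: eq_bigr => w _; rewrite perm_length_ninv //.
by rewrite exprM.
Qed.

Lemma hecke_gen_qsymmetriser i :
  hecke_gen q i * qsymmetriser q r = q *: qsymmetriser q r.
Proof.
by rewrite qsymmetriserE -scalerAr hecke_gen_symm ?quad_q // !scalerA mulrC.
Qed.

Lemma hecke_shift_sum (I : finType) (F : I -> hecke q r) :
  hecke_shift f (\sum_i F i) = \sum_i hecke_shift f (F i).
Proof.
exact: (big_morph (hecke_shift f) (@hecke_shiftD K q p r m f fE)
  (@hecke_shift0 K q p r m f fE)).
Qed.

Lemma hecke_shift_symm lam :
  hecke_shift f (hecke_symm q r lam) =
  \sum_(w : 'S_r) lam ^+ ninv w *: hecke_word q (map f (reduced_word w)).
Proof.
rewrite hecke_shift_sum; apply: eq_bigr => w _.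
by rewrite (hecke_shiftZ fE) (hecke_shift_word q fE).
Qed.

Hypothesis norm_neq0 : \sum_(w : 'S_r) (q ^+ 2) ^+ ninv w != 0.
Variables (N : nat) (c : {ffun 'I_m -> 'I_N}).
Hypothesis c_eq : forall i, c (pos_lo (f i)) = c (pos_hi (f i)).

Lemma rep_word_fixed s :
  hecke_rep N (hecke_word q (map f s)) (tensor_basis K c) =
  q ^+ size s *: tensor_basis K c.
Proof.
elim: s => [|i s IHs] /=; first by rewrite hecke_word_nil hecke_rep1 // id_lfunE scale1r.
rewrite hecke_word_cons hecke_repM // comp_lfunE IHs linearZ /= hecke_rep_gen //.
by rewrite Rcheck_eq // scalerA exprSr.
Qed.

Lemma rep_word_fixed_coord s z :
  hecke_rep N (hecke_word q (map f s)) z c = q ^+ size s * z c.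
Proof.
elim: s => [|i s IHs] /=; first by rewrite hecke_word_nil hecke_rep1 // id_lfunE mul1r.
rewrite hecke_word_cons hecke_repM // comp_lfunE hecke_rep_gen //.
by rewrite Rcheck_coord_eq // IHs mulrA exprS.
Qed.

(** Every generator of the block acts on e_c by q, so the numerator acts by
    the normaliser. *)
Lemma rep_qsymmetriser_fixed :
  hecke_rep N (hecke_shift f (qsymmetriser q r)) (tensor_basis K c) = tensor_basis K c.
Proof.
rewrite qsymmetriserE; move: norm_neq0; set d := (\sum_w _) => d_neq0.
rewrite (hecke_shiftZ fE) hecke_repZ // hecke_shift_symm.
rewrite hecke_rep_sum // scale_lfunE sum_lfunE.
under eq_bigr do rewrite hecke_repZ // scale_lfunE rep_word_fixed scalerA
  size_reduced_word perm_length_ninv -exprD addnn -mul2n exprM.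
by rewrite -scaler_suml -/d scalerA mulVf // scale1r.
Qed.

(** The transposed form of [rep_qsymmetriser_fixed]. *)
Lemma rep_qsymmetriser_coord z :
  hecke_rep N (hecke_shift f (qsymmetriser q r)) z c = z c.
Proof.
rewrite qsymmetriserE; move: norm_neq0; set d := (\sum_w _) => d_neq0.
rewrite (hecke_shiftZ fE) hecke_repZ // hecke_shift_symm.
rewrite hecke_rep_sum // scale_lfunE sum_lfunE ffunE sum_ffunE.
under eq_bigr do rewrite hecke_repZ // scale_lfunE ffunE rep_word_fixed_coord
  /GRing.scale /= mulrA size_reduced_word perm_length_ninv -exprD addnn -mul2n exprM.
by rewrite -mulr_suml -/d /GRing.scale /= mulrA mulVf // mul1r.
Qed.

End Symmetriser.

(** * The antisymmetriser on few letters and on many letters *)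

Section Antisymmetriser.
Variables (K : fieldType) (q : K) (q_neq0 : q != 0) (p r m : nat).
Variables (f : 'I_r.-1 -> 'I_m.-1) (g : 'I_r -> 'I_m).
Hypothesis fE : forall i, f i = (p + i)%N :> nat.
Hypothesis gE : forall a, g a = (p + a)%N :> nat.
Variable N : nat.

Definition antisymm := hecke_shift f (hecke_symm q r (- q^-1)).

(** The letters in the antisymmetrised positions are distinct, so only the term
    of the identity returns to t. *)
Lemma rep_antisymm_coord (t : {ffun 'I_m -> 'I_N}) :
  (forall a b : 'I_r, (a < b)%N -> (t (g b) < t (g a))%N) ->
  hecke_rep N antisymm (tensor_basis K t) t = 1.
Proof.
move=> t_desc; rewrite /antisymm (hecke_shift_symm q fE) hecke_rep_sum //.
rewrite sum_lfunE sum_ffunE.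
have coordE (w : 'S_r) :
    hecke_rep N (hecke_word q (map f (reduced_word w))) (tensor_basis K t) t =
    (w == 1%g)%:R.
  have [->|w1] := eqVneq w 1%g.
    have /size0nil-> : size (reduced_word (1%g : 'S_r)) = 0%N.
      by rewrite size_reduced_word perm_length_ninv ninv1.
    by rewrite hecke_word_nil hecke_rep1 // id_lfunE tensor_basis_coord eqxx.
  have [u -> u_g] := rep_reduced_word q_neq0 fE gE t_desc (reduced_word_ninv w).
  rewrite tensor_basis_coord; case: eqP => // Eu; case/eqP: w1.
  apply/permP=> a; rewrite reduced_wordP -Eu in u_g; rewrite perm1; apply: val_inj.
  by have := u_g a; case: (ltngtP (w a) a) => // /t_desc; move=> + E; rewrite E ltnn.
under eq_bigr do rewrite hecke_repZ // scale_lfunE ffunE coordE.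
rewrite (bigD1 1%g) //= big1 => [|w w1]; last by rewrite (negPf w1) scaler0.
by rewrite eqxx ninv1 /GRing.scale /= mulr1 addr0.
Qed.

Hypothesis qV_neq0 : q + q^-1 != 0.

(** A tensor z in the image satisfies sigma_i z = - q^-1 z on these strands.
    At a word with equal letters at i, i+1 the generator acts on the coordinate
    by q, whence the coordinate vanishes; and the vanishing of a coordinate is
    not affected by swaps of the word, so any repeated letter can be brought
    next to its copy. *)
Lemma rep_antisymm0 : (N < r)%N -> hecke_rep N antisymm = 0.
Proof.
move=> lt_Nr; apply/lfunP=> y; rewrite zero_lfunE.
pose z := hecke_rep N antisymm y; rewrite -/z.
have zE i : Rcheck q N (f i) z = - q^-1 *: z.
  rewrite /z -hecke_rep_gen // -comp_lfunE -hecke_repM // /antisymm.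
  rewrite -(hecke_shift_gen q fE) -(hecke_shiftM fE) hecke_gen_symm ?quad_Vq //.
  by rewrite (hecke_shiftZ fE) hecke_repZ // scale_lfunE.
have zuE i u : Rcheck q N (f i) z u = - q^-1 * z u by rewrite zE ffunE.
have z_eq i (u : {ffun 'I_m -> 'I_N}) : u (pos_lo (f i)) = u (pos_hi (f i)) -> z u = 0.
  move=> Eu; have := zuE i u; rewrite Rcheck_coord_eq // => /eqP.
  by rewrite -subr_eq0 -mulrBl opprK mulf_eq0 (negPf qV_neq0) => /eqP.
have z_swap i (u : {ffun 'I_m -> 'I_N}) : z (tensor_swap (f i) u) = 0 -> z u = 0.
  move=> zu0; have := zuE i u.
  case: (ltngtP (u (pos_lo (f i))) (u (pos_hi (f i)))) => [asc|desc|/val_inj /z_eq //].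
    rewrite Rcheck_coord_asc // zu0 add0r => /eqP; rewrite -subr_eq0 -mulrBl opprK subrK.
    by rewrite mulf_eq0 (negPf q_neq0) => /eqP.
  rewrite Rcheck_coord_desc // zu0 => /eqP; rewrite eq_sym mulf_eq0 oppr_eq0 invr_eq0.
  by rewrite (negPf q_neq0) => /eqP.
(* A swap brings the second letter one step closer to its copy. *)
have z_rep d : forall (a b : 'I_r) (u : {ffun 'I_m -> 'I_N}),
    b = (a + d).+1 :> nat -> u (g a) = u (g b) -> z u = 0.
  elim: d => [|d IHd] a b u Eb Eu.
    have lta : (a < r.-1)%N by have := ltn_ord b; lia.
    pose i := Ordinal lta; apply: (z_eq i).
    have Elo : pos_lo i = a by apply: val_inj.
    have Ehi : pos_hi i = b by apply: val_inj; rewrite /= Eb addn0.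
    by rewrite -(shift_lo fE gE) -(shift_hi fE gE) Elo Ehi.
  have ltb : (b.-1 < r.-1)%N by have := ltn_ord b; lia.
  pose i := Ordinal ltb.
  have Ehi : b = pos_hi i by apply: val_inj; rewrite /=; lia.
  apply: (z_swap i); apply: (IHd a (pos_lo i)); first by rewrite /=; lia.
  rewrite (shift_lo fE gE) tensor_swap_lo -(shift_hi fE gE) -Ehi -Eu.
  apply: tensor_swap_out; rewrite -?(shift_lo fE gE) -?(shift_hi fE gE);
    by rewrite (inj_eq (shift_inj gE)) -val_eqE /=; lia.
apply/ffunP=> u; rewrite ffunE.
have /injectivePn[a [b nab Eab]] : ~~ injectiveb (u \o g).
  apply: contraL lt_Nr => /injectiveP /leq_card; rewrite !card_ord -leqNgt.
  by [].
wlog lt_ab : a b nab Eab / (a < b)%N.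
  move=> IHab; case: (ltngtP a b) => [|lt_ba|/val_inj Ea]; first exact: IHab.
    by apply: (IHab b a); rewrite 1?eq_sym.
  by rewrite Ea eqxx in nab.
by apply: (z_rep (b - a.+1)%N a b) => //; lia.
Qed.

End Antisymmetriser.

(** * Reaching all rearrangements of a decreasing word *)

Section Reach.
Variables (K : fieldType) (q : K) (q_neq0 : q != 0) (N m : nat).
Variables (c : {ffun 'I_m -> 'I_N}).
Hypothesis c_desc : forall i : 'I_m.-1, (c (pos_hi i) <= c (pos_lo i))%N.

Lemma perm_eq_swap i (t : {ffun 'I_m -> 'I_N}) :
  perm_eq (fgraph (tensor_swap i t)) (fgraph t).
Proof. exact: perm_eq_fgraph. Qed.

(** The second clause is the transpose of the first one: the coordinate at c
    after the reversed word is the coordinate at t before it. *)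
Lemma rearrangement_reached (t : {ffun 'I_m -> 'I_N}) : perm_eq (fgraph t) (fgraph c) ->
  exists2 s, hecke_rep N (hecke_word q s) (tensor_basis K c) = tensor_basis K t
           & forall z, hecke_rep N (hecke_word q (rev s)) z c = z t.
Proof.
have [d] := ubnP (moment t); elim: d t => // d IHd t; rewrite ltnS => led tc.
case: (pickP (fun i => t (pos_lo i) < t (pos_hi i)))%N => [i t_i|no]; last first.
  have -> : t = c by apply: descending_eq => // i; rewrite leqNgt no.
  exists [::] => [|z]; by rewrite ?hecke_word_nil hecke_rep1 // id_lfunE.
have u_desc : (tensor_swap i t (pos_hi i) < tensor_swap i t (pos_lo i))%N.
  by rewrite tensor_swap_lo tensor_swap_hi.
have [||s s_t s_z] := IHd (tensor_swap i t).
- exact: leq_trans (moment_swap t_i) led.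
- exact: perm_trans (perm_eq_swap i t) tc.
exists (i :: s) => [|z].
  rewrite hecke_word_cons hecke_repM // comp_lfunE s_t hecke_rep_gen //.
  by rewrite Rcheck_desc // tensor_swapK.
have -> : hecke_word q (rev (i :: s)) = hecke_word q (rev s) * hecke_gen q i.
  by rewrite rev_cons /hecke_word big_rcons.
by rewrite hecke_repM // comp_lfunE s_z hecke_rep_gen // Rcheck_coord_desc // tensor_swapK.
Qed.

End Reach.

(** * The word attached to the blocks *)

Section Blocks.
Variables (k : nat -> nat) (n : nat).

Lemma ksumS j : ksum k j.+1 = (ksum k j + k j)%N.
Proof. by rewrite /ksum big_ord_recr. Qed.

Lemma ksum_mono i j : (i <= j)%N -> (ksum k i <= ksum k j)%N.
Proof.
elim: j => [|j IHj]; first by rewrite leqn0 => /eqP->.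
rewrite leq_eqVlt ltnS => /orP[/eqP->//|/IHj/leq_trans->//].
by rewrite ksumS leq_addr.
Qed.

(** Looking for the first block that ends after a skips the empty blocks. *)
Definition block_index (a : nat) := find (fun j => a < ksum k j.+1)%N (iota 0 n).

Lemma block_indexP a : (a < ksum k n)%N ->
  [/\ (block_index a < n)%N, (ksum k (block_index a) <= a)%N
    & (a < ksum k (block_index a).+1)%N].
Proof.
move=> lta; pose P j := (a < ksum k j.+1)%N.
have hasP_ : has P (iota 0 n).
  case: (posnP n) => [n0|n0]; first by move: lta; rewrite n0 /ksum big_ord0.
  by apply/hasP; exists n.-1; rewrite ?mem_iota /P prednK //= add0n leqnn.
have ltn_b : (block_index a < n)%N.
  by move: hasP_; rewrite has_find size_iota.
have := nth_find 0%N hasP_; rewrite nth_iota // add0n => ub; split=> //.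
case Eb: (block_index a) => [|b]; first by rewrite /ksum big_ord0.
have /(before_find 0%N) : (b < find P (iota 0 n))%N by rewrite -/(block_index a) Eb.
by rewrite nth_iota ?add0n /P; [move/negbT; rewrite -leqNgt | rewrite ltnW // -Eb].
Qed.

Lemma block_index_mono a b : (a <= b)%N -> (b < ksum k n)%N ->
  (block_index a <= block_index b)%N.
Proof.
move=> le_ab ltb; have [_ _ ub] := block_indexP ltb.
have [_ la _] := block_indexP (leq_ltn_trans le_ab ltb).
rewrite leqNgt; apply/negP => /ksum_mono.
by move/(leq_trans ub); lia.
Qed.

Lemma block_index_eq j a : (j < n)%N -> (ksum k j <= a)%N -> (a < ksum k j.+1)%N ->
  block_index a = j.
Proof.
move=> ltj lja aj.
have [_ la ua] := block_indexP (leq_trans aj (ksum_mono ltj)).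
case: (ltngtP (block_index a) j) => [/ksum_mono|/ksum_mono|//]; lia.
Qed.

Definition block_of (a : 'I_(ksum k n)) : 'I_n :=
  let: And3 lt _ _ := block_indexP (ltn_ord a) in Ordinal lt.

Lemma block_ofE a : block_of a = block_index a :> nat.
Proof. by rewrite /block_of; case: block_indexP. Qed.

Variables (N : nat) (le_nN : (n <= N)%N).

(** Letters decrease from block to block, so that a generator that straddles
    two blocks acts on this tensor by a plain swap. *)
Definition block_tensor : {ffun 'I_(ksum k n) -> 'I_N} :=
  [ffun a => widen_ord le_nN (rev_ord (block_of a))].

Lemma block_tensorE a : block_tensor a = (n - (block_index a).+1)%N :> nat.
Proof. by rewrite ffunE /= block_ofE. Qed.

Lemma block_tensor_desc i : (block_tensor (pos_hi i) <= block_tensor (pos_lo i))%N.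
Proof.
rewrite !block_tensorE leq_sub2l // ltnS block_index_mono //=.
exact: ltn_pos_hi.
Qed.

Lemma block_tensor_block (j : 'I_n) (b : 'I_(k j).-1) :
  block_tensor (pos_lo (block_gen b)) = block_tensor (pos_hi (block_gen b)).
Proof.
have ltb : (b.+1 < k j)%N by rewrite -ltn_predRL.
apply: ord_inj; rewrite !block_tensorE /= !(@block_index_eq j) // ?ksumS; lia.
Qed.

Lemma block_tensor_eq (i : 'I_(ksum k n).-1) :
  block_tensor (pos_lo i) = block_tensor (pos_hi i) ->
  exists j : 'I_n, exists b : 'I_(k j).-1, i = block_gen b.
Proof.
move/(congr1 (@nat_of_ord N)); rewrite !block_tensorE => Ei.
have [lt1 lo1 hi1] := block_indexP (ltn_ord (pos_lo i)).
have [lt2 lo2 hi2] := block_indexP (ltn_ord (pos_hi i)).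
have {}Ei : block_index (pos_hi i) = block_index (pos_lo i) by lia.
rewrite Ei /= in lo1 hi1 lo2 hi2; pose j := Ordinal lt1; exists j.
have ltb : (i - ksum k j < (k j).-1)%N by move: hi2; rewrite ksumS /=; lia.
exists (Ordinal ltb); apply: val_inj; rewrite /= subnKC //.
Qed.

End Blocks.

(** * Injectivity for at least n letters *)

Section FusedIdem.
Variables (K : fieldType) (q : K) (q_neq0 : q != 0) (k : nat -> nat) (n : nat).
Variables (N : nat) (le_nN : (n <= N)%N).

Notation c := (@block_tensor k n _ le_nN).
Notation e := (fused_idem q k n).

(** The generator belongs to one block; it commutes with the factors of e that
    precede this block and is absorbed by the factor of the block. *)
Lemma fused_idem_eigen i : c (pos_lo i) = c (pos_hi i) ->
  hecke_gen q i * e = q *: e.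
Proof.
case/block_tensor_eq => j [b ->]; rewrite /fused_idem.
have : j \in index_enum 'I_n by rewrite mem_index_enum.
elim: (index_enum _) => // l s IHs; rewrite in_cons big_cons.
have shE (l' : 'I_n) (i' : 'I_(k l').-1) : block_gen i' = (ksum k l' + i')%N :> nat by [].
have [<- _|n_jl /IHs IH] := eqVneq j l.
  rewrite mulrA -[block_incl _]/(hecke_shift (fun i => block_gen i) _).
  rewrite -(hecke_shift_gen q (@shE j)) -(hecke_shiftM (@shE j)).
  by rewrite hecke_gen_qsymmetriser // (hecke_shiftZ (@shE j)) scalerAl.
rewrite mulrA -[block_incl _]/(hecke_shift (fun i => block_gen i) _).
rewrite (hecke_shift_comm (@shE l)) -?mulrA ?IH ?scalerAr // => b'.
have ltb : (b.+1 < k j)%N by rewrite -ltn_predRL.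
have ltb' : (b'.+1 < k l)%N by rewrite -ltn_predRL.
rewrite /far /=; case: (ltngtP j l) => [/(ksum_mono k)|/(ksum_mono k)|/val_inj Ejl].
- by rewrite ksumS; lia.
- by rewrite ksumS; lia.
- by rewrite Ejl eqxx in n_jl.
Qed.

Hypothesis norm_neq0 : forall r, \sum_(w : 'S_r) (q ^+ 2) ^+ ninv w != 0.

Lemma rep_fused_idem_fixed : hecke_rep N e (tensor_basis K c) = tensor_basis K c.
Proof.
rewrite /fused_idem; elim/big_ind: _ => [|x y Ex Ey|j _].
- by rewrite hecke_rep1 // id_lfunE.
- by rewrite hecke_repM // comp_lfunE Ey.
apply: (@rep_qsymmetriser_fixed _ _ q_neq0 (ksum k j) (k j)) => // b.
exact: block_tensor_block.
Qed.

Lemma rep_fused_idem_coord z : hecke_rep N e z c = z c.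
Proof.
move: z; rewrite /fused_idem; elim/big_ind: _ => [z|x y Ex Ey z|j _ z].
- by rewrite hecke_rep1 // id_lfunE.
- by rewrite hecke_repM // comp_lfunE Ex.
apply: (@rep_qsymmetriser_coord _ _ q_neq0 (ksum k j) (k j)) => // b.
exact: block_tensor_block.
Qed.

(** As rho(e) fixes e_c, the value of x = (e y) e at e_c is that of e y, and by
    Frobenius reciprocity that value determines x. *)
Lemma fused_rep_kernel (x : hecke q (ksum k n)) : fused_hecke x ->
  hecke_rep N x (tensor_basis K c) = 0 -> x = 0.
Proof.
case=> y _ <-; rewrite hecke_repM // comp_lfunE rep_fused_idem_fixed => rho0.
exact: (hecke_rep_inj q_neq0 fused_idem_eigen (block_tensor_desc le_nN) rho0).
Qed.

Lemma fused_coincide_le : fused_coincide q k n N.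
Proof.
split; [by move=> x; exists x | | by []].
move=> x y; rewrite !inE => Hx Hy Exy; apply/eqP; rewrite -subr_eq0; apply/eqP.
apply: fused_rep_kernel.
  case: Hx Hy => x' _ <- [y' _ <-]; exists (x' - y') => //.
  by rewrite mulrBr mulrBl.
have vP : tensor_basis K c \in fused_tensor q k n N.
  by rewrite -rep_fused_idem_fixed memv_img ?memvf.
pose v := Subvs vP.
have := congr1 (fun h : 'End(subvs_of _) => vsval (h v)) Exy.
rewrite /= !fused_repE // => Ev.
by rewrite -scaleN1r hecke_repD // hecke_repZ // add_lfunE scale_lfunE scaleN1r Ev subrr.
Qed.

End FusedIdem.

(** * Failure of injectivity for fewer than n letters *)

Section NonInjective.
Variables (K : fieldType) (q : K) (q_neq0 : q != 0) (k : nat -> nat) (n : nat).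
Hypothesis k_gt0 : forall i, (i < n)%N -> (0 < k i)%N.
Hypothesis qV_neq0 : q + q^-1 != 0.
Hypothesis norm_neq0 : forall r, \sum_(w : 'S_r) (q ^+ 2) ^+ ninv w != 0.

Notation m := (ksum k n).
Notation c := (@block_tensor k n _ (leqnn n)).
Notation e := (fused_idem q k n).

(** Nonempty blocks are what makes all n letters occur. *)
Lemma block_tensor_onto (x : 'I_n) : x \in fgraph c.
Proof.
have ltj := ltn_ord (rev_ord x).
have lta : (ksum k (rev_ord x) < m)%N.
  by apply: leq_trans (ksum_mono k ltj); rewrite ksumS; have := k_gt0 ltj; lia.
rewrite fgraph_codom; apply/codomP; exists (Ordinal lta); apply: ord_inj.
rewrite block_tensorE (@block_index_eq k n (rev_ord x)) //=; first by have := ltn_ord x; lia.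
by rewrite ksumS; have := k_gt0 ltj; rewrite /=; lia.
Qed.

(** All n letters occur in c: list them in decreasing order and append the
    letters that remain. *)
Lemma descending_rearrangement :
  exists2 t : {ffun 'I_m -> 'I_n}, perm_eq (fgraph t) (fgraph c) &
    (n <= m)%N /\ forall a : 'I_m, (a < n)%N -> t a = (n - a.+1)%N :> nat.
Proof.
pose L := rev (enum 'I_n).
have uniqL : uniq L by rewrite rev_uniq enum_uniq.
have /count_subseqP[s' sub_s Ls] : forall x, (count_mem x L <= count_mem x (fgraph c))%N.
  move=> x; rewrite count_uniq_mem // mem_rev mem_enum /=.
  by rewrite -has_count has_pred1 block_tensor_onto.
have [s cE] := perm_to_subseq sub_s.
have {s' sub_s Ls cE} cE : perm_eq (fgraph c) (L ++ s).
  by apply: perm_trans cE _; rewrite perm_cat2r perm_sym.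
have sizeLs : size (L ++ s) = m by rewrite -(perm_size cE) size_tuple card_ord.
have sizeL : size L = n by rewrite size_rev size_enum_ord.
have le_nm : (n <= m)%N by rewrite -sizeLs size_cat sizeL leq_addr.
case: (posnP n) => [n0|n_gt0].
  by exists c => //; split=> // a; lia.
pose x0 := Ordinal n_gt0; exists [ffun a : 'I_m => nth x0 (L ++ s) a].
  rewrite perm_sym; apply: perm_trans cE _.
  suff <- : L ++ s = fgraph [ffun a : 'I_m => nth x0 (L ++ s) a] by [].
  apply: (eq_from_nth (x0 := x0)) => [|i lti]; first by rewrite size_tuple card_ord.
  rewrite sizeLs in lti.
  have := nth_fgraph_ord x0 (Ordinal lti) [ffun a : 'I_m => nth x0 (L ++ s) a].
  by move=> /= ->; rewrite ffunE.
split=> // a lta; rewrite ffunE nth_cat sizeL lta nth_rev ?size_enum_ord //.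
by rewrite nth_enum_ord //; lia.
Qed.

Lemma fused_coincide_gt N : (N < n)%N -> ~ fused_coincide q k n N.
Proof.
move=> lt_Nn [_ inj _].
have [t tc [le_nm t_desc]] := descending_rearrangement.
have le_nm1 : (n.-1 <= m.-1)%N by lia.
pose f := widen_ord le_nm1; pose g := widen_ord le_nm.
have fE i : f i = (0 + i)%N :> nat by [].
have gE a : g a = (0 + a)%N :> nat by [].
have [s s_t s_z] := rearrangement_reached q_neq0 (block_tensor_desc (leqnn n)) tc.
pose A := antisymm q f.
(* The words carry c to t, where A is seen, and back again. *)
pose x := e * (hecke_word q (rev s) * A * hecke_word q s) * e.
have x_fused : fused_hecke x by exists (hecke_word q (rev s) * A * hecke_word q s).
have x0 : x = 0.
  apply: inj; rewrite ?inE //; first by exists 0 => //; rewrite mulr0 mul0r.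
  rewrite /fused_rep !hecke_repM // (rep_antisymm0 q_neq0 fE gE qV_neq0 lt_Nn).
  by rewrite comp_lfun0r comp_lfun0l comp_lfun0r comp_lfun0l hecke_rep0.
have : hecke_rep n x (tensor_basis K c) c = 1.
  rewrite /x !hecke_repM // !comp_lfunE rep_fused_idem_fixed // s_t.
  rewrite rep_fused_idem_coord // s_z (rep_antisymm_coord q_neq0 fE gE) // => a b ab.
  by rewrite !t_desc //=; have := ltn_ord b; lia.
rewrite x0 hecke_rep0 // zero_lfunE ffunE => /esym/eqP.
by rewrite oner_eq0.
Qed.

End NonInjective.

(** * The criterion *)

Theorem corollary8p5 (R : realType) (q : R[i]) (q_neq0 : q != 0)
  (q_generic : forall m : nat, (0 < m)%N -> (q ^+ 2) ^+ m = 1 -> q ^+ 2 = 1)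
  (k : nat -> nat) (N n : nat) (N_gt1 : (1 < N)%N) :
  ((n <= N)%N -> fused_coincide q k n N) /\
  ((forall i : nat, (i < n)%N -> (0 < k i)%N) ->
   (fused_coincide q k n N <-> (n <= N)%N)).
Proof.
have char0 i : i.+1%:R != 0 :> R[i] by rewrite Num.Theory.pnatr_eq0.
have norm_neq0 r := poincare_neq0 char0 q_generic r.
have qV_neq0 : q + q^-1 != 0.
  apply/eqP => q0; have q2 : q ^+ 2 = -1.
    by apply/eqP; rewrite -subr_eq0 opprK -(mulfV q_neq0) expr2 -mulrDr q0 mulr0.
  have : q ^+ 2 = 1 by apply: (q_generic 2%N) => //; rewrite q2 sqrrN expr1n.
  rewrite q2 => /eqP; rewrite eq_sym -subr_eq0 opprK.
  by rewrite -[1 + 1]/(2%:R) (negPf (char0 1%N)).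
split=> [le_nN|k_gt0]; first exact: (fused_coincide_le q_neq0 k le_nN norm_neq0).
split=> [coinc|le_nN]; last exact: (fused_coincide_le q_neq0 k le_nN norm_neq0).
rewrite leqNgt; apply/negP => lt_Nn.
exact: (fused_coincide_gt q_neq0 k_gt0 qV_neq0 norm_neq0 lt_Nn coinc).
Qed.
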